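(* Let $k$ be an algebraically closed field extension of $\mathbb{F}_{p^2}$, $x\in\mathcal N(k)$, and $M=M_0\oplus M_1\subset\mathbf N_k$ the corresponding unitary Dieudonné module. Let $s$ be an integer with $0\le s\le\frac{n-1}{2}$. Then $x\in\mathcal N(s)(k)$ if and only if the superspecial gap $\sigma(M)$ equals $s$.
   Context: Let $p>2$ be a prime, $K$ the unramified quadratic extension of $\mathbb{Q}_p$ with ring of integers $O_K$ and nontrivial automorphism $a\mapsto a^\star$; $\mathbb{Z}_{p^2}=W(\mathbb{F}_{p^2})$ with Frobenius $\sigma$, and $\varphi_0,\varphi_1=\varphi_0\circ\star$ the two embeddings $K\to\mathbb{Z}_{p^2}[1/p]$. Fix $n\ge2$. A unitary $p$-divisible group of signature $(1,n-1)$ over a $\mathbb{Z}_{p^2}$-scheme $S$ with $p$ locally nilpotent is $(X,\iota_X,\lambda_X)$: $X$ a $p$-divisible group, $\iota_X:O_K\to\mathrm{End}(X)$ with $\mathrm{charpol}(\iota_X(a)|\mathrm{Lie}X)=(T-\varphi_0(a))(T-\varphi_1(a))^{n-1}$, $\lambda_X:X\to{}^tX$ an $O_K$-linear principal polarization. Fix such an $\mathbf X$ over $\mathbb{F}_{p^2}$, superspecial, with isocrystal $(\mathbf N,\mathbf F,\mathbf V)$ satisfying $\mathbf F^2=p$. $\mathcal N$ is the formal scheme over $\mathrm{Spf}\,\mathbb{Z}_{p^2}$ representing isomorphism classes of $(X,\iota_X,\lambda_X,\rho_X)$ with $\rho_X:X\times_S\bar S\to\mathbf X\times\bar S$ an $O_K$-linear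 quasi-isogeny such that ${}^t\rho_X\circ\lambda_{\mathbf X}\circ\rho_X$ is locally a $\mathbb{Q}_p^\times$-multiple of $\lambda_X$. By covariant Dieudonné theory a point $x\in\mathcal N(k)$ corresponds to an $\mathcal F,\mathcal V$-stable $W(k)$-lattice $M\subset\mathbf N_k=\mathbf N\otimes_{\mathbb{Z}_{p^2}}W(k)$ (with $\mathcal F=\mathbf F\otimes\sigma$), and $M=M_0\oplus M_1$ according to the decomposition of $\mathbf N_k$ induced by $O_K\otimes W(k)\cong W(k)\times W(k)$, $a\otimes w\mapsto(\varphi_0(a)w,\varphi_1(a)w)$. Superspecial gap: $\tau=p^{-1}\mathcal F^2$ on $\mathbf N_k$, $\Lambda^+(M)=\sum_{l\ge0}\tau^l(M)=\Lambda^+(M)_0\oplus\Lambda^+(M)_1$, and $\sigma(M)=\inf\{d\ge0:\Lambda^+(M)_0=\sum_{l=0}^d\tau^l(M_0)\}$. Ekedahl-Oort strata: over $\mathbb{F}_{p^2}$ let $\mathbb S$ have basis $g$ (degree $0$), $h$ (degree $1$), $\langle h,g\rangle=1$, $\sigma$-linear $\mathcal F$, $\sigma^{-1}$-linear $\mathcal V$ with $\mathcal F(h)=-g$, $\mathcal V(g)=h$, $\mathcal F(g)=\mathcal V(h)=0$; for $d\ge1$ let $\mathbb B(d)$ have basis $e_1..e_d$ (degree $0$), $f_1..f_d$ (degree $1$), $\langle e_a,f_b\rangle=(-1)^a\delta_{ab}$, $\mathcal V(f_b)=e_{b+1}$ ($b<d$), $\mathcal V(e_d)=f_1$, $\mathcal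 F(f_b)=e_{b-1}$ ($b\ge2$), $\mathcal F(e_1)=(-1)^df_d$, other basis vectors killed. $\mathcal N(s)$ is the locally closed formal subscheme of $\mathcal N\otimes\mathbb{F}_{p^2}$ of points $X$ with $X[p]$ fppf-locally isomorphic to the unitary level-1 truncated Barsotti-Tate group $\overline{\mathbb X}_s$ with Dieudonné space $\mathbb B(2s+1)\oplus\mathbb S^{n-2s-1}$; over algebraically closed $k$, $x\in\mathcal N(s)(k)$ iff $M/pM\cong(\mathbb B(2s+1)\oplus\mathbb S^{n-2s-1})\otimes k$ compatibly with grading, $\mathcal F,\mathcal V$ and pairings.
   Formalization: The space S is taken with V(h) = g and V(g) = 0 instead of V(g) = h and V(h) = 0; as written FV(g) = -g is nonzero, so S is not a Dieudonné space and N(s) would be empty whenever 2s+1 < n, although superspecial points have gap 0. *)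

(* Defs.v *)
From HB Require Import structures.
From mathcomp Require Import all_boot all_order all_algebra.
Import GRing.Theory.
Local Open Scope ring_scope.

(* The coefficient field L = W(k)[1/p], its valuation ring W = W(k), the     *)
(* residue field k = W/pW (algebraically closed, char p), the Frobenius      *)
(* they are characterised axiomatically (complete DVR, uniformiser p,        *)
(* residue field k, sigma = the lift of Frobenius), which pins down          *)
(* (L, W, sigma) up to isomorphism.                                          *)
Record WittSetting := {
  wp : nat;
  wL : fieldType;
  wW : wL -> Prop;
  wk : closedFieldType;
  wred : wL -> wk;
  wsig : wL -> wL;
  wsigi : wL -> wL }.

Set Implicit Arguments. Unset Strict Implicit. Unset Printing Implicit Defensive.

Definition pL (S : WittSetting) : wL S := (wp S)%:R.

Record WittAxioms (S : WittSetting) : Prop := {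
  wa_prime : prime (wp S);
  wa_odd : (2 < wp S)%N;
  wa_p0 : pL S != 0;
  wa_W1 : wW S 1;
  wa_WD : forall x y, wW S x -> wW S y -> wW S (x + y);
  wa_WN : forall x, wW S x -> wW S (- x);
  wa_WM : forall x y, wW S x -> wW S y -> wW S (x * y);
  wa_Wp : wW S (pL S);
  wa_Wpinv : ~ wW S (pL S)^-1;
  wa_dvr : forall x : wL S, x != 0 ->
     exists (m : int) (u : wL S), [/\ wW S u, wW S u^-1 & x = pL S ^ m * u];
  wa_complete : forall a : nat -> wL S, (forall i, wW S (a i)) ->
     exists x, wW S x /\ forall N : nat,
        wW S ((x - \sum_(i < N) a i * pL S ^+ i) / pL S ^+ N);
  wa_redD : forall x y, wW S x -> wW S y -> wred S (x + y) = wred S x + wred S y;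
  wa_redM : forall x y, wW S x -> wW S y -> wred S (x * y) = wred S x * wred S y;
  wa_red1 : wred S 1 = 1;
  wa_red_surj : forall a : wk S, exists x, wW S x /\ wred S x = a;
  wa_red_ker : forall x, wW S x -> (wred S x = 0 <-> wW S (x / pL S));
  wa_sigD : forall x y, wsig S (x + y) = wsig S x + wsig S y;
  wa_sigM : forall x y, wsig S (x * y) = wsig S x * wsig S y;
  wa_sig1 : wsig S 1 = 1;
  wa_sigK : cancel (wsig S) (wsigi S);
  wa_sigiK : cancel (wsigi S) (wsig S);
  wa_sigW : forall x, wW S (wsig S x) <-> wW S x;
  wa_sig_frob : forall x, wW S x -> wred S (wsig S x) = wred S x ^+ wp S }.

Section Unitary.
Variables (S : WittSetting) (n : nat).
Local Notation L := (wL S).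
Local Notation k := (wk S).
Local Notation W := (wW S).
Local Notation p := (pL S).
Local Notation vec := 'rV[L]_(n + n).

(* N_k = L^n (+) L^n: first block = degree 0 (O_K acts through phi_0),      *)
(* second block = degree 1 (O_K acts through phi_1), in a basis of the       *)
(* rational isocrystal N.  F x = sigma(x) A,  V y = sigma^-1(y) A  (= p F^-1 *)
(* since sigma(A) A = p),  <x,y> = x J y^T.                                  *)
Variables (A J : 'M[L]_(n + n)).

Definition Fop (x : vec) : vec := map_mx (wsig S) x *m A.
Definition Vop (x : vec) : vec := map_mx (wsigi S) x *m A.
Definition tau (x : vec) : vec := p^-1 *: Fop (Fop x).
Definition pairing (x y : vec) : L := (x *m J *m y^T) 0 0.

(* lattices in L^d, given by a basis matrix B (rows = basis vectors) *)
Definition lat_of d (B : 'M[L]_d) (x : 'rV[L]_d) : Prop :=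
  forall i, W ((x *m invmx B) 0 i).
Definition is_lattice d (M : 'rV[L]_d -> Prop) : Prop :=
  exists B : 'M[L]_d, B \in unitmx /\ forall x, M x <-> lat_of B x.

Definition pval (x : L) (r : nat) : Prop :=
  exists u, [/\ W u, W u^-1 & x = p ^+ r * u].

(* length of M / M' for lattices M' ⊆ M (= v(det) of the transition matrix) *)
Definition lat_index d (M M' : 'rV[L]_d -> Prop) (r : nat) : Prop :=
  exists B B' : 'M[L]_d, [/\ B \in unitmx, B' \in unitmx,
    (forall x, M x <-> lat_of B x), (forall x, M' x <-> lat_of B' x)
    & pval (\det (B' *m invmx B)) r].

Definition img (f : vec -> vec) (M : vec -> Prop) (y : vec) : Prop :=
  exists x, M x /\ y = f x.

Definition part0 (M : vec -> Prop) (y : 'rV[L]_n) : Prop := M (row_mx y 0).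
Definition part1 (M : vec -> Prop) (y : 'rV[L]_n) : Prop := M (row_mx 0 y).

Definition self_dual (c : L) (M : vec -> Prop) : Prop :=
  forall x, M x <-> (forall y, M y -> W (c^-1 * pairing x y)).

Definition unitary_dieudonne (M : vec -> Prop) : Prop :=
  is_lattice M /\
  (forall x, M x -> M (Fop x)) /\
  (forall x, M x -> M (Vop x)) /\
  (forall x, M x -> M (row_mx (lsubmx x) 0) /\ M (row_mx 0 (rsubmx x))) /\
  (* signature (1, n-1): Lie X = M / VM has graded dims (1, n-1) *)
  lat_index (part0 M) (part0 (img Vop M)) 1 /\
  lat_index (part1 M) (part1 (img Vop M)) (n - 1) /\
  exists c : L, [/\ c != 0, wsig S c = c & self_dual c M].

End Unitary.

Record IsoAxioms (S : WittSetting) (n : nat) (A J : 'M[wL S]_(n + n)) : Prop := {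
  ia_A00 : ulsubmx A = 0;
  ia_A11 : drsubmx A = 0;
  ia_F2 : map_mx (wsig S) A *m A = (pL S)%:M;       (* F^2 = p on N *)
  ia_Jalt : J^T = - J;
  ia_Junit : J \in unitmx;
  ia_J00 : ulsubmx J = 0;
  ia_J11 : drsubmx J = 0;
  ia_JF : A *m J *m A^T = pL S *: map_mx (wsig S) J;  (* <Fx,Fy> = p <x,y>^sigma *)
  (* the base point X: principally polarized, superspecial (FM = VM) *)
  ia_base : exists MX : 'rV[wL S]_(n + n) -> Prop,
     [/\ unitary_dieudonne A J MX, self_dual J 1 MX
       & forall y, img (Fop A) MX y <-> img (Vop A) MX y] }.

(* Ekedahl-Oort strata.  Dieudonne space B(d) (+) S^(n-d), d = 2s+1,         *)
(* basis ordered: degree 0 = e_1..e_d, g_1..g_(n-d); degree 1 = f_1..f_d,     *)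
(* h_1..h_(n-d).  Row-vector convention: row i of a matrix = image of basis  *)
(* vector i.  (For S we use F(h) = -g, V(h) = g, F(g) = V(g) = 0.) *)
Section EO.
Variables (K : fieldType) (n d : nat).

Definition DF01 : 'M[K]_n := \matrix_(i < n, j < n)
  (if ((i : nat) == 0%N) && ((j : nat) == d.-1) then (-1) ^+ d else 0).
Definition DF10 : 'M[K]_n := \matrix_(i < n, j < n)
  (if (i < d)%N then (if (0 < i)%N && ((j : nat) == i.-1) then 1 else 0)
   else (if (j : nat) == i then -1 else 0)).
Definition DV01 : 'M[K]_n := \matrix_(i < n, j < n)
  (if ((i : nat) == d.-1) && ((j : nat) == 0%N) then 1 else 0).
Definition DV10 : 'M[K]_n := \matrix_(i < n, j < n)
  (if (i < d)%N then (if (i.+1 < d)%N && ((j : nat) == i.+1) then 1 else 0)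
   else (if (j : nat) == i then 1 else 0)).
Definition DG01 : 'M[K]_n := \matrix_(i < n, j < n)
  (if (j : nat) == i then (if (i < d)%N then (-1) ^+ i.+1 else -1) else 0).

Definition DF : 'M[K]_(n + n) := block_mx 0 DF01 DF10 0.
Definition DV : 'M[K]_(n + n) := block_mx 0 DV01 DV10 0.
Definition DG : 'M[K]_(n + n) := block_mx 0 DG01 (- DG01^T) 0.
End EO.

Section Strata.
Variables (S : WittSetting) (n : nat) (A J : 'M[wL S]_(n + n)).
Local Notation L := (wL S).
Local Notation k := (wk S).
Local Notation vec := 'rV[L]_(n + n).

Definition frob_mx m m' (X : 'M[k]_(m, m')) := map_mx (fun a => a ^+ wp S) X.

(* x in N(s)(k): M/pM ≅ (B(2s+1) (+) S^(n-2s-1)) ⊗ k compatibly with grading,*)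
(* F, V and pairings.  M/pM is described through a graded W-basis B of M:   *)
(* F, V, <,> on M/pM have matrices red(sigma(B) A B^-1), red(sigma^-1(B) A   *)
(* B^-1), red(c^-1 B J B^T) (c normalising the polarization); a k-linear     *)
(* graded isomorphism ubar |-> ubar P is compatible iff the equations hold.  *)
Definition EO_stratum (s : nat) (M : vec -> Prop) : Prop :=
  exists (c : L) (B0 B1 : 'M[L]_n) (P0 P1 : 'M[k]_n),
    let B := block_mx B0 0 0 B1 in
    let P := block_mx P0 0 0 P1 in
    let CF := map_mx (wsig S) B *m A *m invmx B in
    let CV := map_mx (wsigi S) B *m A *m invmx B in
    let G := c^-1 *: (B *m J *m B^T) in
    [/\ c != 0, wsig S c = c, self_dual J c M,
        B \in unitmx & forall x, M x <-> lat_of B x] /\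
    [/\ P \in unitmx,
        map_mx (wred S) CF *m P = frob_mx P *m DF k n (2 * s + 1),
        frob_mx (map_mx (wred S) CV *m P) = P *m frob_mx (DV k n (2 * s + 1))
      & map_mx (wred S) G = P *m DG k n (2 * s + 1) *m P^T].

Definition tsum (M : vec -> Prop) (d : nat) (y : vec) : Prop :=
  exists xs : 'I_d.+1 -> vec,
    (forall l, M (xs l)) /\ y = \sum_(l < d.+1) iter l (tau A) (xs l).
Definition Lambda_plus (M : vec -> Prop) (y : vec) : Prop :=
  exists d, tsum M d y.
Definition deg0 (M : vec -> Prop) (y : vec) : Prop := M y /\ rsubmx y = 0.

Definition gap_ok (M : vec -> Prop) (d : nat) : Prop :=
  forall y, deg0 (Lambda_plus M) y <-> tsum (deg0 M) d y.

Definition superspecial_gap (M : vec -> Prop) (s : nat) : Prop :=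
  gap_ok M s /\ forall d, (d < s)%N -> ~ gap_ok M d.

End Strata.

(* Main.v *)
Require Import Defs.
From HB Require Import structures.
From mathcomp Require Import all_boot all_order all_algebra.
From mathcomp Require Import zify ring.
Set Implicit Arguments. Unset Strict Implicit. Unset Printing Implicit Defensive.
Import GRing.Theory.
Local Open Scope ring_scope.

(**
On N_k the operator tau is sigma^2 on coordinates.  Self-duality identifies M_1
with the dual of M_0, so M/pM is determined by the form (x, y) |-> <x, V y> on
M_1/pM_1, which is linear in x, Frobenius-semilinear in y and of corank one (the
signature), together with one scalar fixing V on M_0/pM_0.  Over an algebraically
closed field such a form is the sum of one nilpotent chain of length d and of
orthonormal vectors: split off the right kernel and induct, the nondegenerate
part being diagonalised by Lang's theorem for x |-> x^(p^2).  Hence M/pM is always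
B(d) + S^(n-d) for some 1 <= d <= n.

In a basis of M_0 lifting the standard one, the matrix of tau is read off from F
and V modulo p: M_0 + ... + tau^i M_0 is M_0 together with e_(d-1)/p, e_(d-3)/p,
..., e_(d+1-2i)/p.  For d = 2s+1 this chain grows strictly for s steps and then is
tau-stable; for d even it reaches e_1/p, whose image under tau has a pole of
order two, and the chain grows without bound.
*)

(** * Frobenius-semilinear forms over an algebraically closed field *)

(** The obstacle is that M/pM knows F and V only modulo p, whereas tau = p^-1 F^2 divides by p. Two
    relations recover enough. On M_0, p tau = F^2 shows that tau has a denominator in one place
    only: e_1 goes to (-1)^d e_(d-1)/p plus integral terms. On M_1, tau V = F gives tau e_b modulo p
    for 2 <= b <= d, up to a multiple of e_(d-1). That unknown coefficient is harmless, since a pole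
    of the same order at e_(d-1) is already available to cancel it. Parity then decides: poles start
    at e_(d-1) and move from e_b to e_(b-2), so they meet e_1 only when d is even.

    The form is p-semilinear, yet Lang's theorem is applied to x^(p^2): being Hermitian compares the
    form with its own Frobenius transpose, and a change of basis enters that comparison through two
    Frobenius twists. Oddness of p provides an anisotropic vector. The implication from the gap to
    the stratum is indirect: the classification puts M in the class of some d, even d has no gap,
    and distinct odd d have distinct gaps. *)

Lemma closed_nth_root (K : closedFieldType) (n : nat) (a : K) :
  (0 < n)%N -> exists x, x ^+ n = a.
Proof.
move=> n0; have [x xE] := @solve_monicpoly K n (fun i => if i is 0 then a else 0) n0.
exists x; rewrite xE; case: n n0 {xE} => // n _.
by rewrite big_ord_recl big1 ?addr0 ?expr0 ?mulr1 // => i _; rewrite mul0r.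
Qed.

Lemma artin_schreier_root (K : closedFieldType) (q : nat) (a : K) :
  (1 < q)%N -> exists x, x ^+ q + a = x.
Proof.
case: q => [|[|q]] // _.
have [x xE] := @solve_monicpoly K q.+2
  (fun i => if i is 0 then - a else if i is 1 then 1 else 0) isT.
exists x; rewrite xE !big_ord_recl big1 => [|i _]; last by rewrite mul0r.
by rewrite /= expr0 expr1; ring.
Qed.

Lemma matrix_neq0_entry (K : fieldType) m n (X : 'M[K]_(m, n)) :
  X != 0 -> exists i j, X i j != 0.
Proof.
move=> X0; have [/existsP[i /existsP[j Xij]]|/existsPn H] :=
  boolP [exists i, exists j, X i j != 0]; first by exists i, j.
case/eqP: X0; apply/matrixP => i j; rewrite mxE.
by move/existsPn: (H i) => /(_ j)/negPn/eqP.
Qed.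

Lemma invmx_mulmx (K : fieldType) n (U B : 'M[K]_n) :
  U \in unitmx -> B \in unitmx -> invmx (U *m B) = invmx B *m invmx U.
Proof.
move=> uU uB; have uUB : U *m B \in unitmx by rewrite unitmx_mul uU.
by rewrite -[RHS](mulKmx uUB) -mulmxA (mulKVmx uB) mulmxV // mulmx1.
Qed.

Lemma complete_row (K : fieldType) m (x : 'rV[K]_(1 + m)) :
  x != 0 -> exists2 Q : 'M[K]_(1 + m), Q \in unitmx & usubmx Q = x.
Proof.
move=> x0; exists (block_mx (col_ebase x) 0 0 1%:M *m row_ebase x).
  rewrite unitmx_mul row_ebase_unit andbT unitmxE det_lblock det1 mulr1.
  by rewrite -unitmxE col_ebase_unit.
have rk : \rank x = 1%N by rewrite rank_rV x0.
rewrite -[RHS](mulmx_ebase x) rk -mul_usub_mx block_mxEv col_mxKu.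
by rewrite pid_mx_row mul_mx_row mulmx1 mulmx0.
Qed.

(* If psi is q-semilinear and psi^(r+1) v = \sum_(i <= r) a_i psi^i v, these are the
   equations making \sum_(i <= r) c_i psi^i v a fixed vector of psi. *)
Lemma companion_frob_solution (K : closedFieldType) (q r : nat) (a : nat -> K) :
  (1 < q)%N -> (exists2 i, (i <= r)%N & a i != 0) ->
  exists c : nat -> K, [/\ c r != 0, c 0%N = c r ^+ q * a 0%N &
    forall i, c i.+1 = c i ^+ q + c r ^+ q * a i.+1].
Proof.
move=> q1 [i0 i0r ai0].
(* With x = c_r as the unknown, c_i = C_i(x) and the remaining equation is C_r(x) = x. Since C_r = D
   X^q, it suffices to solve D X^(q-1) = 1, whose roots are automatically nonzero. *)
pose C := fix C i : {poly K} :=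
  if i is j.+1 then C j ^+ q + a i *: 'X^q else a 0%N *: 'X^q.
have CX i : exists D, C i = D * 'X^q.
  elim: i => [|i [D CE]] /=; first by exists (a 0%N)%:P; rewrite mul_polyC.
  exists (D ^+ q * 'X^q ^+ q.-1 + (a i.+1)%:P).
  rewrite CE mulrDl mul_polyC exprMn -mulrA -exprSr prednK //; lia.
have Cneq0 i : C i = 0 -> forall j, (j <= i)%N -> a j = 0.
  elim: i => [|i IH] /=.
    by move/eqP; rewrite scaler_eq0 expf_eq0 polyX_eq0 andbF orbF => /eqP a0 [].
  have [D CE] := CX i; move=> E.
  have ai : a i.+1 = 0.
    move/(congr1 (fun P : {poly K} => P`_q)): E.
    rewrite coefD coefZ coefXn eqxx mulr1 coef0 CE exprMn -exprM coefMXn.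
    have -> : (q < q * q)%N by nia.
    by rewrite add0r.
  move: E; rewrite ai scale0r addr0 => /eqP; rewrite expf_eq0 => /andP[_ /eqP Ci0].
  move=> j; rewrite leq_eqVlt => /orP[/eqP->//|]; exact: IH.
have [D CE] := CX r.
have D0 : D != 0.
  apply/eqP=> D0; move/eqP: ai0; apply; apply: (Cneq0 r) => //.
  by rewrite CE D0 mul0r.
have [x /rootP rx] : exists x, root (D * 'X^(q.-1) - 1) x.
  apply/closed_rootP; apply/negP => /eqP/eqP/size_poly1P[b b0 E].
  have : (D * 'X^(q.-1)) = (b + 1)%:P by rewrite polyCD -E; ring.
  move/(congr1 (fun P : {poly K} => size P)).
  rewrite size_mulXn //.
  have := D0; rewrite -size_poly_gt0 size_polyC; case: (_ != 0) => /=; lia.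
move: rx; rewrite !hornerE => rx.
exists (fun i => (C i).[x]); have xE : (C r).[x] = x.
  rewrite CE hornerM hornerXn -(ltn_predK q1) exprSr mulrA.
  by rewrite (_ : D.[x] * _ = 1) ?mul1r //; apply/eqP; rewrite -subr_eq0 rx.
rewrite xE; split.
- apply/eqP => x0; move/eqP: rx; rewrite x0 expr0n.
  have -> : (q.-1 == 0)%N = false by lia.
  by rewrite mulr0 add0r oppr_eq0 oner_eq0.
- by rewrite /= hornerZ hornerXn mulrC.
- by move=> i; rewrite /= hornerD hornerZ hornerXn horner_exp [a _ * _]mulrC.
Qed.

(** * Lang's theorem for GL_n *)

Section Lang.
Variables (K : closedFieldType) (q : nat) (g : {rmorphism K -> K}).
Hypotheses (q1 : (1 < q)%N) (gE : forall x, g x = x ^+ q).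

Lemma frob_fixed_vector n (Z : 'M[K]_n) : (0 < n)%N -> Z \in unitmx ->
  exists2 x : 'rV[K]_n, x != 0 & map_mx g x *m Z = x.
Proof.
case: n Z => // n Z _ uZ.
pose psi (x : 'rV[K]_n.+1) := map_mx g x *m Z.
have psiD x y : psi (x + y) = psi x + psi y by rewrite /psi map_mxD mulmxDl.
have psiZ c x : psi (c *: x) = c ^+ q *: psi x.
  by rewrite /psi map_mxZ gE scalemxAl.
have psi0 : psi 0 = 0 by rewrite /psi map_mx0 mul0mx.
have psi_sum I (s : seq I) P (f : I -> 'rV_n.+1) :
    psi (\sum_(i <- s | P i) f i) = \sum_(i <- s | P i) psi (f i).
  exact: (big_morph _ psiD psi0).
have psi_neq0 x : x != 0 -> psi x != 0.
  apply: contraNN; rewrite /psi => /eqP E; rewrite -(map_mx_eq0 g).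
  by rewrite -[map_mx g x](mulmxK uZ) E mul0mx.
pose v : 'rV[K]_n.+1 := const_mx 1.
have v0 : v != 0.
  by apply/eqP => /rowP/(_ 0); rewrite !mxE => /eqP; rewrite oner_eq0.
(* The first linear dependence among v, psi v, psi^2 v, ... gives the companion equation; its
   coefficients are not all zero because psi is injective. *)
pose dep r := iter r psi v \in <<traject psi v r>>%VS.
have [r0 dep0] : exists r, dep r.
  have [/existsP[i Hi]|/existsPn H] := boolP [exists i : 'I_n.+2, dep i].
    by exists i.
  have fr r : (r <= n.+2)%N -> free (traject psi v r).
    elim: r => [|r IH] rn; first by rewrite nil_free.
    rewrite trajectSr (perm_free (_ : perm_eq _ (iter r psi v :: traject psi v r))).
      rewrite free_cons IH ?(ltnW rn) // andbT.
      exact: (H (Ordinal rn)).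
    by rewrite perm_rcons.
  move: (fr _ (leqnn _)); rewrite /free size_traject => /eqP E.
  have := dimvS (subvf <<traject psi v n.+2>>); rewrite E dimvf /dim /= mul1n.
  by rewrite ltnn.
have := ex_minnP (ex_intro _ r0 dep0); case=> r depr rmin.
case: r depr rmin => [|r].
  by rewrite /dep /= span_nil memv0 (negPf v0).
rewrite /dep => depr rmin.
have vr : iter r.+1 psi v \notin [:: 0].
  rewrite inE; elim: r.+1 => //= k IH; exact: psi_neq0.
have sX : size (traject psi v r.+1) == r.+1 by rewrite size_traject.
pose X := Tuple sX.
pose a i := if insub i is Some j then coord X j (iter r.+1 psi v) else 0.
have aE (j : 'I_r.+1) : a j = coord X j (iter r.+1 psi v).
  by rewrite /a valK.
have vE : iter r.+1 psi v = \sum_(j < r.+1) a j *: iter j psi v.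
  rewrite {1}(@coord_span _ _ _ X _ depr); apply: eq_bigr => j _.
  rewrite aE (set_nth_default v) ?size_traject //.
  by rewrite (nth_traject psi (ltn_ord j)).
have [|c [cr c0 cS]] := @companion_frob_solution K q r a q1.
  have [/existsP[j Hj]|/existsPn H] := boolP [exists j : 'I_r.+1, a j != 0].
    by exists j; first by rewrite -ltnS.
  move: vr; rewrite vE big1 ?inE ?eqxx // => j _.
  by move/negPn/eqP: (H j) => ->; rewrite scale0r.
exists (\sum_(j < r.+1) c j *: iter j psi v).
  (* If the fixed vector vanished, then c_r != 0 would express psi^r v through earlier iterates,
     against the minimality of r + 1. *)
  rewrite big_ord_recr /=; apply/eqP => E.
  suff: dep r by move/rmin; rewrite ltnn.
  rewrite /dep -[iter r _ _]scale1r -(mulVf cr) -scalerA memvZ //.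
  rewrite -[_ *: _](addKr (\sum_(i < r) c i *: iter i psi v)) E addr0 memvN.
  apply: memv_suml => i _; apply: memvZ; apply: memv_span.
  by rewrite -(nth_traject psi (ltn_ord i)) mem_nth // size_traject.
rewrite -/(psi _) psi_sum.
under eq_bigr do rewrite psiZ -iterS.
rewrite big_ord_recr /= -iterS vE scaler_sumr.
rewrite [in X in _ + X]big_ord_recl [RHS]big_ord_recl addrCA; congr (_ + _).
  by rewrite scalerA c0.
rewrite -big_split; apply: eq_bigr => i _ /=.
by rewrite scalerA -scalerDl /bump /= add1n cS.
Qed.

(** A fixed vector, taken as first basis vector, makes Z block lower triangular with corner 1. The
    lower right block is handled by induction, and the column below the corner by Artin-Schreier
    equations e^q + b = e. *)
Lemma lang_GL n (Z : 'M[K]_n) : Z \in unitmx ->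
  exists2 Q : 'M[K]_n, Q \in unitmx & map_mx g Q *m Z = Q.
Proof.
elim: n Z => [|m IH] Z uZ.
  by exists 1%:M; rewrite ?unitmx1 // [LHS]flatmx0 [RHS]flatmx0.
have [x x0 xE] := frob_fixed_vector (ltn0Sn m) uZ.
move: Z uZ x x0 xE; rewrite -[m.+1]/(1 + m)%N => Z uZ x x0 xE.
have [Q1 uQ1 Q1x] := complete_row x0.
pose Z1 := map_mx g Q1 *m Z *m invmx Q1.
have uZ1 : Z1 \in unitmx by rewrite !unitmx_mul unitmx_inv map_unitmx uQ1 uZ.
have Z1u : usubmx Z1 = row_mx 1%:M 0.
  rewrite /Z1 -!mul_usub_mx -map_usubmx Q1x xE -Q1x mul_usub_mx mulmxV //.
  by rewrite scalar_mx_block block_mxEv col_mxKu.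
have Z1E : Z1 = block_mx 1%:M 0 (dlsubmx Z1) (drsubmx Z1).
  by rewrite -[LHS]submxK /ulsubmx /ursubmx Z1u row_mxKl row_mxKr.
have uZ' : drsubmx Z1 \in unitmx.
  by move: uZ1; rewrite Z1E !unitmxE det_lblock det1 mul1r block_mxKdr.
have [Q2 uQ2 Q2E] := IH _ uZ'.
have AS (b : 'cV[K]_m) : exists e : 'cV[K]_m, map_mx g e + b = e.
  have H i : exists x, x ^+ q + b i 0 == x.
    by have [y yE] := artin_schreier_root (b i 0) q1; exists y; rewrite yE.
  exists (\col_i xchoose (H i)); apply/matrixP => i j.
  by rewrite !mxE gE (ord1 j) (eqP (xchooseP (H i))).
have [e eE] := AS (map_mx g Q2 *m dlsubmx Z1).
have QE : map_mx g (block_mx 1%:M 0 e Q2) *m Z1 = block_mx 1%:M 0 e Q2.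
  rewrite Z1E map_block_mx mulmx_block map_mx1 map_mx0 !mul0mx !mulmx1 !mulmx0.
  by rewrite !addr0 add0r Q2E eE.
exists (block_mx 1%:M 0 e Q2 *m Q1).
  by rewrite unitmx_mul uQ1 andbT unitmxE det_lblock det1 mul1r -unitmxE.
by rewrite map_mxM -{2}QE /Z1 -!mulmxA mulVmx // mulmx1.
Qed.
End Lang.

(** Only the support is prescribed; a diagonal change of basis normalises the values later. For d =
    0 there is no chain and the form is nondegenerate; for d > 0 column 0 and row d - 1 vanish. *)
Definition chain_pattern (K : fieldType) n d (E : 'M[K]_n) :=
  forall i j : 'I_n, (E i j != 0) =
    ((j < d)%N && ((j : nat) == i.+1)) || ((d <= i)%N && (i == j)).

(** Rows and columns of E have at most one nonzero entry each, so the coordinates of r can be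
    cleared independently, except at the zero column 0 of a chain. *)
Lemma chain_pattern_clear (K : fieldType) n d (E : 'M[K]_n) (r : 'rV[K]_n) :
  chain_pattern d E -> exists y : 'rV[K]_n,
    forall j : 'I_n, ((0 < d)%N -> (0 < j)%N) -> (r + y *m E) 0 j = 0.
Proof.
move=> Epat.
exists (\row_i \sum_j (if E i j == 0 then 0 else - r 0 j / E i j)).
move=> j jd.
have nj := ltn_ord j.
have pn : ((if (j < d)%N then j.-1 else j) < n)%N by case: ifP; lia.
pose i := Ordinal pn.
have Eij : E i j != 0.
  rewrite Epat /= -val_eqE /=; case: ifP => jd'; last by rewrite eqxx; lia.
  by have := jd (leq_ltn_trans (leq0n j) jd'); lia.
rewrite !mxE (bigD1 i) //= big1 => [|i' ii']; last first.
  case E0: (E i' j == 0); first by rewrite (eqP E0) mulr0.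
  move: E0 ii' => /negbT; rewrite Epat -!val_eqE /=; case: ifP; lia.
rewrite mxE addr0 (bigD1 j) //= big1 => [|j' jj']; last first.
  case: ifP => // /negbT; move: jj' Eij; rewrite !Epat -!val_eqE /=.
  case: ifP; lia.
by rewrite (negPf Eij) addr0 divfK // addrN.
Qed.

(** * Classification of Frobenius-semilinear forms of corank at most one *)

Section FrobeniusForms.
Variables (K : closedFieldType) (p : nat).
Hypothesis chKp : p \in [pchar K].
Local Notation fr := (pFrobenius_aut chKp).
Local Notation "X ^fr" := (map_mx fr X) (at level 2, format "X ^fr").

Let p_gt1 : (1 < p)%N. Proof. by rewrite prime_gt1 // (pcharf_prime chKp). Qed.

Lemma frob_mx_surj m n (X : 'M[K]_(m, n)) : exists Y : 'M[K]_(m, n), Y^fr = X.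
Proof.
have H a : exists x : K, x ^+ p == a.
  by have [x <-] := closed_nth_root a (ltnW p_gt1); exists x.
exists (map_mx (fun a => xchoose (H a)) X); apply/matrixP => i j.
by rewrite !mxE /= pFrobenius_autE; apply/eqP/(xchooseP (H _)).
Qed.

(** Change of basis for the form b(x, y) = x N (y^fr)^T, linear in x and Frobenius-semilinear in
    y. *)
Definition fcong n (N N' : 'M[K]_n) :=
  exists2 Q : 'M[K]_n, Q \in unitmx & Q *m N *m (Q^fr)^T = N'.

Lemma fcong_trans n (N1 N2 N3 : 'M[K]_n) :
  fcong N1 N2 -> fcong N2 N3 -> fcong N1 N3.
Proof.
move=> [Q uQ <-] [Q' uQ' <-]; exists (Q' *m Q); first by rewrite unitmx_mul uQ'.
by rewrite map_mxM trmx_mul !mulmxA.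
Qed.

Lemma fcong_rank n (N N' : 'M[K]_n) : fcong N N' -> \rank N' = \rank N.
Proof.
move=> [Q uQ <-]; rewrite mxrankMfree; last first.
  by rewrite row_free_unit unitmx_tr map_unitmx.
by rewrite eqmxMfull // row_full_unit.
Qed.

Lemma fcong_unit n (N N' : 'M[K]_n) :
  fcong N N' -> N \in unitmx -> N' \in unitmx.
Proof.
by move=> [Q uQ <-] uN; rewrite !unitmx_mul unitmx_tr map_unitmx uQ uN.
Qed.

Lemma fcong_block n (e : 'M[K]_(1, 1)) (r : 'rV[K]_n) (c : 'cV[K]_n)
    (N H : 'M[K]_n) : H \in unitmx ->
  fcong (block_mx e r c N)
        (block_mx e (r *m (H^fr)^T) (H *m c) (H *m N *m (H^fr)^T)).
Proof.
move=> uH; exists (block_mx 1%:M 0 0 H).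
  by rewrite unitmxE det_lblock det1 mul1r -unitmxE.
rewrite map_block_mx tr_block_mx !mulmx_block map_mx1 !map_mx0 !trmx0 trmx1.
by rewrite !mul0mx !mulmx0 !mulmx1 !mul1mx !addr0 !add0r.
Qed.

Lemma hermitian_anisotropic n (N : 'M[K]_n) : (2 < p)%N ->
  N = (N^fr)^T -> N != 0 ->
  exists2 y : 'rV[K]_n, (y^fr)^fr = y & (y *m N *m (y^fr)^T) 0 0 != 0.
Proof.
move=> p2 hN N0.
have NE i j : N i j ^+ p = N j i by rewrite {2}hN !mxE.
have p20 : (2%:R : K) != 0.
  apply/negP => H; have : (2 \in [pchar K]) by rewrite inE.
  by rewrite (pcharf_eq chKp) inE => /eqP E; rewrite -E in p2.
have [/existsP[i Ni]|/existsPn diag0] := boolP [exists i, N i i != 0].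
  exists (delta_mx 0 i); first by rewrite !map_delta_mx.
  by rewrite map_delta_mx trmx_delta -rowE -colE !mxE.
have [i [j Nij]] := matrix_neq0_entry N0.
have Nji : N j i != 0 by rewrite -NE expf_neq0.
(* When all diagonal entries vanish, each of the two cross terms is 1 for this vector, so the value
   is 2, which is nonzero as p > 2. *)
exists (delta_mx 0 i + (N j i)^-1 *: delta_mx 0 j).
  rewrite !map_mxD !map_mxZ !map_delta_mx /= !pFrobenius_autE !exprVn.
  by rewrite (NE j i) NE.
rewrite !map_mxD !map_mxZ !map_delta_mx /= !pFrobenius_autE !exprVn NE.
rewrite linearD linearZ /= !trmx_delta !mulmxDl !mulmxDr -!scalemxAl -!scalemxAr.
rewrite -!rowE -!colE !mxE.
have /negPn/eqP-> := diag0 i; have /negPn/eqP-> := diag0 j.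
by rewrite mulVf // mulVf // !mulr0 add0r addr0 -[1 + 1]/(2%:R).
Qed.

(* Lang's theorem makes N Hermitian; a vector x fixed by Frobenius^2 then has equal
   left and right orthogonals, so it splits off once b(x, x) = 1. *)
Lemma frob_form_unit n (N : 'M[K]_n) : (2 < p)%N ->
  N \in unitmx -> fcong N 1%:M.
Proof.
move=> p2; elim: n N => [|m IH] N uN.
  by exists 1%:M; rewrite ?unitmx1 // [LHS]flatmx0 [RHS]flatmx0.
have q1 : (1 < p * p)%N by nia.
have gE x : (fr \o fr) x = x ^+ (p * p) by rewrite /= !pFrobenius_autE exprM.
(* For this Z, Lang's equation reads Q N = Q^(fr^2) (N^fr)^T, which says exactly that Q N (Q^fr)^T
   is Hermitian. *)
have uZ : (N^fr)^T *m invmx N \in unitmx.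
  by rewrite unitmx_mul unitmx_inv unitmx_tr map_unitmx uN.
have [Q uQ QE] := lang_GL q1 gE uZ.
pose N1 := Q *m N *m (Q^fr)^T.
have c1 : fcong N N1 by exists Q.
have uN1 := fcong_unit c1 uN.
have hN1 : N1 = (N1^fr)^T.
  have E1 : Q *m N = map_mx (fr \o fr) Q *m (N^fr)^T.
    by rewrite -{1}QE -!mulmxA mulVmx // mulmx1.
  rewrite {1}/N1 E1 /N1 !map_mxM !trmx_mul map_mx_comp -map_trmx trmxK.
  by rewrite mulmxA.
clearbody N1.
have N10 : N1 != 0.
  by apply: contraTneq uN1 => ->; rewrite unitmxE det0 unitr0.
have [y y2 yb] := hermitian_anisotropic p2 hN1 N10.
set b := (_ *m _) 0 0 in yb.
have bp : b ^+ p = b.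
  rewrite -[LHS]/(fr b) /b.
  have -> : forall X : 'M[K]_1, fr (X 0 0) = (X^fr)^T 0 0 by move=> X; rewrite !mxE.
  by rewrite !map_mxM !trmx_mul -map_trmx trmxK y2 -hN1 map_trmx mulmxA.
(* Scaling y by l multiplies b by l^(p+1). As b lies in the prime field, l^(p^2) = l, so the scaled
   vector is still fixed by Frobenius^2. *)
have [l lE] := closed_nth_root b^-1 (ltn0Sn p).
have l0 : l != 0.
  by apply: contraNneq yb => l0; rewrite -invr_eq0 -lE l0 exprS mul0r.
have l2 : (l ^+ p) ^+ p = l.
  apply: (mulIf (expf_neq0 p l0)).
  by rewrite -exprMn -exprSr lE exprVn bp -exprS lE.
pose x := l *: y.
have x2 : (x^fr)^fr = x by rewrite /x !map_mxZ /= !pFrobenius_autE l2 y2.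
have xx : x *m N1 *m (x^fr)^T = 1%:M.
  rewrite /x map_mxZ linearZ /= -scalemxAr -!scalemxAl scalerA pFrobenius_autE.
  rewrite -exprSr lE [X in _ *: X]mx11_scalar -/b -mul_scalar_mx -scalar_mxM.
  by rewrite mulVf.
have x0 : x != 0.
  apply/eqP => x0; move: xx; rewrite x0 !mul0mx => /matrixP/(_ 0 0)/esym/eqP.
  by rewrite !mxE oner_eq0.
move: N1 y N uN uZ Q uQ QE c1 uN1 hN1 N10 y2 b yb bp lE x x2 xx x0.
rewrite -[m.+1]/(1 + m)%N => N1 y N uN uZ Q uQ QE c1 uN1 hN1 N10 y2 b yb bp lE x.
move=> x2 xx x0.
have [Q1 uQ1 Q1x] := complete_row x0.
pose D := dsubmx Q1; pose c := D *m N1 *m (x^fr)^T; pose N' := D *m N1 *m (D^fr)^T.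
have c2 : fcong N1 (block_mx 1%:M (c^fr)^T c N').
  exists Q1 => //; rewrite -[Q1]vsubmxK Q1x -/D map_col_mx tr_col_mx.
  rewrite mul_col_mx mul_col_row xx -/c -/N'; congr block_mx.
  by rewrite /c !map_mxM !trmx_mul -map_trmx trmxK x2 -hN1 mulmxA.
have c3 : fcong (block_mx 1%:M (c^fr)^T c N') (block_mx 1%:M 0 0 (N' - c *m (c^fr)^T)).
  exists (block_mx 1%:M 0 (- c) 1%:M).
    by rewrite unitmxE det_lblock !det1 mul1r unitr1.
  rewrite map_block_mx tr_block_mx map_mxN linearN /= !map_mx1 map_mx0 trmx0 trmx1.
  rewrite !mulmx_block !mul1mx !mulmx1 !mul0mx !mulmx0 !addr0 !mul1mx addNr mul0mx add0r.
  by rewrite !trmx1 !mulmx1 addNr mulNmx addrC.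
have c4 := fcong_trans (fcong_trans c1 c2) c3.
have uN' : N' - c *m (c^fr)^T \in unitmx.
  by move: (fcong_unit c4 uN); rewrite !unitmxE det_lblock det1 mul1r.
have [H uH HE] := IH _ uN'.
apply: fcong_trans c4 _.
have := fcong_block 1%:M 0 0 (N' - c *m (c^fr)^T) uH.
by rewrite HE mul0mx mulmx0 -scalar_mx_block.
Qed.

Lemma unitmx_rank n (N : 'M[K]_n) : (n <= \rank N)%N -> N \in unitmx.
Proof. by move=> rN; rewrite -row_full_unit /row_full eqn_leq rank_leq_col. Qed.

Lemma rank_col_mx_le m1 m2 n (X : 'M[K]_(m1, n)) (Y : 'M[K]_(m2, n)) :
  (\rank (col_mx X Y) <= \rank X + \rank Y)%N.
Proof. by rewrite -addsmxE mxrank_adds_leqif. Qed.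

(** Multiples of the first row remove e and c; the accompanying column operation only adds multiples
    of column 0, which is zero. *)
Lemma fcong_clear m (e : 'M[K]_1) (r : 'rV[K]_m) (c : 'cV[K]_m) (E : 'M[K]_m) :
  fcong (block_mx 0 (row_mx 1%:M 0) 0 (block_mx e r c E) : 'M_(1 + (1 + m)))
        (block_mx 0 (row_mx 1%:M 0) 0 (block_mx 0 r 0 E)).
Proof.
exists (block_mx 1%:M 0 (- col_mx e c) 1%:M).
  by rewrite unitmxE det_lblock !det1 mul1r unitr1.
rewrite map_block_mx tr_block_mx !map_mx1 map_mx0 trmx0 !trmx1.
rewrite !mulmx_block !mul1mx !mulmx1 !mul0mx !mulmx0 !addr0 !mul0mx !add0r.
congr block_mx; rewrite mulNmx mul_mx_row mulmx1 mulmx0 block_mxEh.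
by rewrite opp_row_mx add_row_mx addNr oppr0 add0r block_mxEh col_mx0.
Qed.

(* If w spans the right kernel and is not in the left one, choose z with b(w, z) = 1;
   the form restricted to the right orthogonal of w modulo w has dimension n - 2 and
   chain d', and w, z prolong this chain to d' + 2. *)
Lemma frob_form_chain n (N : 'M[K]_n) : (2 < p)%N -> (n <= (\rank N).+1)%N ->
  exists E d, [/\ (d <= n)%N, fcong N E & chain_pattern d E].
Proof.
move=> p2; have [k] := ubnP n; elim: k n N => // k IH [|m] N.
  move=> _ _; exists N, 0%N; split => //; last by case.
  by exists 1%:M; rewrite ?unitmx1 // [LHS]flatmx0 [RHS]flatmx0.
rewrite ltnS => mk rN.
have [uN|nuN] := boolP (N \in unitmx).
  exists 1%:M, 0%N; split => //; first exact: frob_form_unit.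
  by move=> i j; rewrite mxE /=; case: (i == j); rewrite ?oner_neq0 ?eqxx.
(* N v^T = 0 describes the right kernel after Frobenius; the vector w with b(-, w) = 0 is the
   Frobenius preimage of v. *)
have [v v0 vN] : exists2 v : 'rV_m.+1, v != 0 & v *m N^T = 0.
  by apply/det0P; rewrite det_tr; move: nuN; rewrite unitmxE unitfE negbK.
have [w wv] := frob_mx_surj v.
have w0 : w != 0 by apply: contraNneq v0 => w0; rewrite -wv w0 map_mx0.
move: N mk rN nuN v v0 vN w wv w0; rewrite -[m.+1]/(1 + m)%N.
move=> N mk rN nuN v v0 vN w wv w0.
have [Q1 uQ1 Q1w] := complete_row w0.
pose N1 := Q1 *m N *m (Q1^fr)^T.
have c1 : fcong N N1 by exists Q1.
have N1l : lsubmx N1 = 0.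
  rewrite /N1 -[Q1 in Q1^fr]vsubmxK Q1w map_col_mx tr_col_mx mul_mx_row row_mxKl.
  rewrite wv -mulmxA (_ : N *m v^T = 0) ?mulmx0 //.
  by rewrite -[LHS]trmxK trmx_mul trmxK vN trmx0.
pose rho : 'rV[K]_m := usubmx (rsubmx N1); pose N2 := dsubmx (rsubmx N1).
have N1E : N1 = block_mx 0 rho 0 N2.
  by rewrite block_mxEh col_mx0 vsubmxK -{1}N1l hsubmxK.
clearbody rho N2.
rewrite N1E in c1; rewrite -(fcong_rank c1) in rN.
(* Here w also lies in the left kernel, so it is a chain of length 1 orthogonal to a nondegenerate
   part. *)
have [rho0|rho0] := eqVneq rho 0.
  have uN2 : N2 \in unitmx.
    apply: unitmx_rank; rewrite rho0 in rN; move: rN.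
    by rewrite block_mxEh col_mx0 rank_row_0mx rank_col_0mx.
  have [H uH HE] := frob_form_unit p2 uN2.
  exists (block_mx 0 0 0 1%:M), 1%N; split => //.
    have := fcong_block 0 rho 0 N2 uH.
    by rewrite rho0 in c1 *; rewrite HE mul0mx mulmx0; apply: fcong_trans.
  move=> i j.
  case: (split_ordP i) => i' ->; case: (split_ordP j) => j' ->;
    rewrite ?block_mxEul ?block_mxEur ?block_mxEdl ?block_mxEdr ?mxE;
    rewrite -?val_eqE /= ?ord1 ?eqxx //=.
  all: try (by rewrite ?eqxx; lia).
  rewrite -?[i' == j']val_eqE /=.
  by case E: ((i' : nat) == j'); rewrite ?oner_neq0 ?eqxx /=; lia.
case: m rho N2 {N1 N1l N1E Q1 uQ1 Q1w w wv w0 v v0 vN nuN} N mk rN c1 rho0.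
  by move=> rho N2 N _ _ _ /eqP[]; rewrite [LHS]thinmx0.
move=> m; rewrite -[m.+1]/(1 + m)%N => rho N2 N mk rN c1 rho0.
have [R uR Rrho] := complete_row rho0.
have [H HR] := frob_mx_surj (invmx R)^T.
have uH : H \in unitmx by rewrite -(map_unitmx fr) HR unitmx_tr unitmx_inv.
have c2 := fcong_trans c1 (fcong_block 0 rho 0 N2 uH).
move: c2; rewrite HR trmxK -{1}Rrho mul_usub_mx mulmxV // mulmx0.
have -> : usubmx (1%:M : 'M[K]_(1 + m)) = row_mx 1%:M 0.
  by rewrite scalar_mx_block block_mxEv col_mxKu.
move: (H *m N2 *m _) => N4 c2.
have [e [r [c [N5 N4E]]]] : exists e r c N5, N4 = block_mx e r c N5.
  by exists (ulsubmx N4), (ursubmx N4), (dlsubmx N4), (drsubmx N4); rewrite submxK.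
rewrite N4E in c2.
(* This bound serves twice: [N5] has corank at most one, and later [r3] cannot vanish when E is
   singular. *)
have rkle (X : 'M[K]_m) (z : 'rV[K]_m) :
    (\rank (block_mx 0 (row_mx 1%:M 0) 0 (block_mx 0 z 0 X) : 'M_(1 + (1 + m)))
      <= 1 + ((z != 0%R) + \rank X))%N.
  rewrite block_mxEv; apply: leq_trans (rank_col_mx_le _ _) _.
  apply: leq_add; first exact: rank_leq_row.
  rewrite rank_row_0mx block_mxEv; apply: leq_trans (rank_col_mx_le _ _) _.
  by rewrite !rank_row_0mx rank_rV.
rewrite (fcong_rank c1) in rN.
have [|| E [d [dm [H2 uH2 EE] Epat]]] := IH m N5.
- lia.
- have := rkle N5 r; rewrite (fcong_rank (fcong_clear e r c N5)) (fcong_rank c2).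
  by case: (r != 0%R); lia.
have [y yE] := chain_pattern_clear (r *m (H2^fr)^T) Epat.
(* Besides normalising [N5] to E, this adds y H2 to z, which leaves in the row of z at most the
   entry at the head of the chain of E. *)
pose H3 := block_mx 1%:M (y *m H2) 0 H2.
have uH3 : H3 \in unitmx by rewrite unitmxE det_ublock det1 mul1r -unitmxE.
pose r3 := r *m (H2^fr)^T + y *m E.
have H3E : H3 *m block_mx e r c N5 *m (H3^fr)^T =
    block_mx (ulsubmx (H3 *m block_mx e r c N5 *m (H3^fr)^T)) r3
             (dlsubmx (H3 *m block_mx e r c N5 *m (H3^fr)^T)) E.
  rewrite -{1}[LHS]submxK; congr block_mx.
    rewrite /H3 map_block_mx tr_block_mx !mulmx_block block_mxKur.
    rewrite map_mx0 !trmx0 mulmx0 add0r mul1mx mulmxDl -!mulmxA.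
    by rewrite [H2 *m _]mulmxA EE.
  rewrite /H3 map_block_mx tr_block_mx !mulmx_block block_mxKdr.
  by rewrite map_mx0 !trmx0 mulmx0 add0r mul0mx add0r EE.
have c3 := fcong_trans c2 (fcong_block 0 (row_mx 1%:M 0) 0 (block_mx e r c N5) uH3).
rewrite H3E mulmx0 (_ : row_mx 1%:M 0 *m _ = row_mx 1%:M 0) in c3; last first.
  rewrite /H3 map_block_mx tr_block_mx mul_row_block map_mx1 map_mx0 trmx0 trmx1.
  by rewrite !mul0mx !mulmx1 mulmx0 !addr0.
have c4 := fcong_trans c3 (fcong_clear _ _ _ _).
exists (block_mx 0 (row_mx 1%:M 0) 0 (block_mx 0 r3 0 E)), d.+2; split => //.
(* For d > 0, E is singular; with [r3] = 0 the total rank would be at most m, while it is at least m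
   + 1. This entry links z to the old chain. *)
have r30 (j : 'I_m) : (j : nat) = 0%N -> (0 < d)%N -> r3 0 j != 0.
  move=> j0 d0; apply/eqP => rj.
  have r30 : r3 = 0.
    apply/rowP => j'; rewrite [RHS]mxE; case: (posnP j') => j'0; last exact: yE.
    by rewrite (_ : j' = j) //; apply: val_inj; rewrite /= j0 j'0.
  have nE : (\rank E < m)%N.
    rewrite ltnNge; apply/negP => /unitmx_rank uE.
    have Ej : E *m (delta_mx j 0 : 'cV_m) = 0.
      rewrite -colE; apply/colP => i; rewrite !mxE; apply/eqP/negPn.
      by rewrite Epat -val_eqE /= j0; lia.
    have := mulKmx uE (delta_mx j 0 : 'cV_m); rewrite Ej mulmx0.
    by move/matrixP/(_ j 0)/eqP; rewrite !mxE !eqxx eq_sym oner_eq0.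
  have := rkle E r3; rewrite (fcong_rank c4) r30 eqxx /=.
  by move: rN nE; lia.
move=> i j.
case: (split_ordP i) => i' ->; case: (split_ordP j) => j' ->;
  rewrite ?block_mxEul ?block_mxEur ?block_mxEdl ?block_mxEdr.
- by rewrite !mxE eqxx -val_eqE /= !ord1.
- case: (split_ordP j') => j'' ->; rewrite ?row_mxEl ?row_mxEr !mxE !ord1 -val_eqE /=.
    by rewrite ?eqxx ?oner_neq0.
  by rewrite eqxx; lia.
- by rewrite !mxE eqxx -val_eqE /= !ord1 /=; lia.
case: (split_ordP i') => i'' ->; case: (split_ordP j') => j'' ->;
  rewrite ?block_mxEul ?block_mxEur ?block_mxEdl ?block_mxEdr.
- by rewrite !mxE eqxx -val_eqE /= !ord1 /=; lia.
- rewrite !ord1 -val_eqE /= !add1n /=.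
  have [/eqP j0|j0] := boolP ((j'' : nat) == 0%N); last first.
    rewrite [r3 0 j'']yE; last by lia.
    by rewrite eqxx; lia.
  case: (posnP d) => d0; last by rewrite r30 // j0; lia.
  by rewrite [r3 0 j'']yE ?eqxx; lia.
- by rewrite !mxE eqxx -val_eqE /= !ord1 /=; lia.
- by rewrite Epat -!val_eqE /=; lia.
Qed.

End FrobeniusForms.
(* Eliminating c_i downwards leaves one equation G * x ^ ((-p)^d) = x. *)
Lemma cyclic_scaling (K : closedFieldType) (p d : nat) (gam : nat -> K) :
  (1 < p)%N -> (0 < d)%N -> (forall i, gam i != 0) ->
  exists c : nat -> K, [/\ forall i, c i != 0,
    forall i, (i.+1 < d)%N -> c i * c i.+1 ^+ p = gam i
    & c d.-1 * c 0%N ^+ p = gam d.-1].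
Proof.
move=> p1 d0 gam0.
(* b x k stands for c_(d-k), with c_d read as c_0 = x; closing the cycle means b x d = x. *)
pose b x := fix b k : K := if k is k'.+1 then gam (d - k)%N / b k' ^+ p else x.
have b0 x k : x != 0 -> b x k != 0.
  by move=> x0; elim: k => //= k IH; rewrite mulf_neq0 // invr_eq0 expf_neq0.
have bE k : exists2 G, G != 0 & forall x, x != 0 ->
    b x k = if odd k then G / x ^+ (p ^ k) else G * x ^+ (p ^ k).
  elim: k => [|k [G G0 IH]] /=.
    by exists 1; [rewrite oner_neq0 | move=> x _; rewrite mul1r].
  exists (gam (d - k.+1)%N / G ^+ p); first by rewrite mulf_neq0 ?invr_eq0 ?expf_neq0.
  move=> x x0; rewrite IH // expnSr exprM.
  have y0 : x ^+ (p ^ k) != 0 by rewrite expf_neq0.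
  move: (x ^+ _) y0 => y y0.
  by case: (odd k); rewrite /= ?exprMn ?exprVn invfM ?invrK mulrA.
have [G G0 GE] := bE d.
have pd : (1 < p ^ d)%N.
  apply: (leq_trans p1); rewrite -{1}[p]expn1.
  by apply: leq_pexp2l => //; exact: ltnW p1.
have [x x0 bx] : exists2 x, x != 0 & b x d = x.
  case od: (odd d).
    have [x xE] := closed_nth_root G (ltn0Sn (p ^ d)).
    have x0 : x != 0 by apply: contraNneq G0 => x0; rewrite -xE x0 exprS mul0r.
    by exists x => //; rewrite GE // od -xE exprS mulfK // expf_neq0.
  have pd1 : (0 < (p ^ d).-1)%N by lia.
  have [x xE] := closed_nth_root G^-1 pd1.
  have x0 : x != 0.
    apply: contraNneq G0 => x0; rewrite -invr_eq0 -xE x0 expr0n.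
    by rewrite eqn0Ngt pd1.
  exists x => //; rewrite GE // od -(ltn_predK pd) exprSr xE mulrA mulfV //.
  by rewrite mul1r.
exists (fun i => b x (d - i)%N); split => [i|i id|]; first exact: b0.
- have -> : (d - i = (d - i.+1).+1)%N by lia.
  rewrite /= divfK ?expf_neq0 ?b0 //; congr gam; lia.
- rewrite subn0 bx (_ : d - d.-1 = 1)%N; last by lia.
  by rewrite /= divfK ?expf_neq0 // subn1.
Qed.

(** * Simultaneous normal form of the two blocks of V modulo p *)

Section StandardForm.
Variables (K : closedFieldType) (p : nat).
Hypothesis chKp : p \in [pchar K].
Local Notation fr := (pFrobenius_aut chKp).
Local Notation "X ^fr" := (map_mx fr X) (at level 2, format "X ^fr").

Lemma DG01E (F : fieldType) n d : DG01 F n d =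
  diag_mx (\row_(j < n) if (j < d)%N then (-1) ^+ j.+1 else -1).
Proof.
apply/matrixP => i j; rewrite !mxE -val_eqE eq_sym.
by case: eqVneq => [->|]; rewrite ?mulr1n ?mulr0n.
Qed.

(** Since N has corank one, the relations N^T R = R N^T = 0 leave R one entry, joining the two ends
    of the chain. A diagonal rescaling of the chain has d unknowns for its d - 1 entries and this
    extra scalar, a cyclic system. R != 0 also forces d > 0. *)
Lemma frob_form_standard n (N R : 'M[K]_n) : (2 < p)%N ->
  (n <= (\rank N).+1)%N -> R != 0 -> N^T *m R = 0 -> R *m N^T = 0 ->
  exists d (P : 'M[K]_n), [/\ (0 < d <= n)%N, P \in unitmx,
    N = P *m (DV10 K n d *m DG01 K n d) *m (P^fr)^T
    & P^T *m R *m P^fr = DG01 K n d *m DV01 K n d].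
Proof.
move=> p2 rN R0 NR RN.
have [E [d [dn [Q uQ QE] Epat]]] := frob_form_chain chKp p2 rN.
have uQf : Q^fr \in unitmx by rewrite map_unitmx.
have uQt : Q^T \in unitmx by rewrite unitmx_tr.
pose R1 := invmx Q^T *m R *m invmx Q^fr.
have ER : E^T *m R1 = 0.
  rewrite -QE !trmx_mul trmxK /R1 -!mulmxA (mulKVmx uQt) [N^T *m _]mulmxA NR.
  by rewrite mul0mx mulmx0.
have RE : R1 *m E^T = 0.
  rewrite -QE !trmx_mul trmxK /R1 -!mulmxA (mulKmx uQf) [R *m _]mulmxA RN.
  by rewrite mul0mx mulmx0.
have R10 : R1 != 0.
  apply: contraNneq R0 => R10.
  by rewrite -[R](mulKVmx uQt) -[invmx _ *m R](mulmxKV uQf) -/R1 R10 mul0mx mulmx0.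
have R1def : R1 = invmx Q^T *m R *m invmx Q^fr by [].
clearbody R1.
(* Unless i = d - 1, row i of E has a nonzero entry, alone in its column j; the (j, k) entry of E^T
   R1 is then E i j times R1 i k. *)
have R1_row i k : R1 i k != 0 -> (i.+1 : nat) = d.
  move=> Rik; apply/eqP/negPn/negP => id.
  have ni := ltn_ord i.
  have jn : ((if (i < d)%N then i.+1 else i) < n)%N by case: ifP; lia.
  pose j := Ordinal jn.
  have Eij : E i j != 0 by rewrite Epat -val_eqE /=; case: ifP; lia.
  move/matrixP/(_ j k)/eqP: ER; rewrite !mxE (bigD1 i) //= big1 ?addr0 => [|i' ii'].
    by rewrite mxE mulf_eq0 (negPf Eij) (negPf Rik).
  rewrite mxE; case E0: (E i' j == 0); first by rewrite (eqP E0) mul0r.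
  by move: E0 ii' => /negbT; rewrite Epat -!val_eqE /=; case: ifP; lia.
have R1_col i k : R1 i k != 0 -> (k : nat) = 0%N /\ (0 < d)%N.
  move=> Rik; suff: ~~ ((0 < d)%N ==> (0 < k)%N) by lia.
  apply/negP => kd.
  have nk := ltn_ord k.
  have jn : ((if (k < d)%N then k.-1 else k) < n)%N by case: ifP; lia.
  pose j := Ordinal jn.
  have Ejk : E j k != 0 by rewrite Epat -val_eqE /=; case: ifP; lia.
  move/matrixP/(_ i j)/eqP: RE; rewrite !mxE (bigD1 k) //= big1 ?addr0 => [|k' kk'].
    by rewrite mxE mulf_eq0 (negPf Ejk) (negPf Rik).
  rewrite mxE; case E0: (E j k' == 0); first by rewrite (eqP E0) mulr0.
  by move: E0 kk' => /negbT; rewrite Epat -!val_eqE /=; case: ifP; lia.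
have [i0 [k0 Rik]] := matrix_neq0_entry R10.
have i0E := R1_row _ _ Rik; have [k0E d0] := R1_col _ _ Rik.
have R1E : R1 = R1 i0 k0 *: delta_mx i0 k0.
  apply/matrixP => i k; rewrite !mxE.
  case: (boolP ((i == i0) && (k == k0))) => [/andP[/eqP-> /eqP->]|ik].
    by rewrite mulr1.
  rewrite mulr0; apply/eqP; apply: contraNT ik => Rik0.
  have iE := R1_row _ _ Rik0; have [kE _] := R1_col _ _ Rik0.
  by rewrite -!val_eqE /=; lia.
pose sg j : K := if (j < d)%N then (-1) ^+ j.+1 else -1.
have sg0 j : sg j != 0.
  by rewrite /sg; case: ifP => _; rewrite ?signr_eq0 ?oppr_eq0 ?oner_eq0.
pose En i j : K := if insub i is Some i' then
  (if insub j is Some j' then E i' j' else 0) else 0.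
have EnE (i j : 'I_n) : En i j = E i j by rewrite /En !valK.
(* The first branch normalises the chain entries of N, the second, at i = d - 1, the single entry of
   R. *)
pose gam i := if (i.+1 < d)%N then En i i.+1 / sg i.+1 else sg i / R1 i0 k0.
have gam0 i : gam i != 0.
  rewrite /gam; case: ifP => id; rewrite mulf_neq0 ?invr_eq0 //.
  have i1 : (i < n)%N by lia. have i2 : (i.+1 < n)%N by lia.
  by rewrite -[i]/(val (Ordinal i1)) -[X in En _ X]/(val (Ordinal i2)) EnE Epat /= eqxx id.
have p1 := ltnW p2.
have [c [c0 cE cd]] := cyclic_scaling p1 d0 gam0.
(* Off the chain, c'_i ^ (p+1) = - E_ii, as the standard form has diagonal entries -1 there. *)
have H i : exists x, x ^+ p.+1 == - En i i.
  by have [x <-] := closed_nth_root (- En i i) (ltn0Sn p); exists x.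
pose c' i := if (i < d)%N then c i else xchoose (H i).
pose C : 'M[K]_n := diag_mx (\row_i c' i).
have c'0 (i : 'I_n) : c' i != 0.
  rewrite /c'; case: ifP => // id; apply/eqP => x0.
  have /eqP := xchooseP (H i); rewrite x0 exprS mul0r => /esym/eqP.
  by rewrite oppr_eq0 EnE; apply/negP; rewrite Epat eqxx; lia.
have uC : C \in unitmx.
  by rewrite unitmxE det_diag unitfE; apply/prodf_neq0 => i _; rewrite mxE.
have Cfr : C^fr = diag_mx (\row_i (c' i ^+ p)).
  by apply/matrixP => i j; rewrite !mxE rmorphMn /= pFrobenius_autE.
exists d, (invmx Q *m C); split.
- by rewrite d0.
- by rewrite unitmx_mul unitmx_inv uQ.
- have CE : C *m (DV10 K n d *m DG01 K n d) *m (C^fr)^T = E.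
    rewrite Cfr DG01E tr_diag_mx mul_diag_mx !mul_mx_diag.
    apply/matrixP => i j; rewrite !mxE.
    case: (eqVneq (E i j) 0) => Eij.
      have := Epat i j; rewrite Eij eqxx /= => /esym/negbT H'.
      suff -> : (if (i < d)%N then if (i.+1 < d)%N && (j == i.+1 :> nat) then 1 else 0
                 else if j == i :> nat then 1 else 0) = 0 :> K by rewrite !(mulr0, mul0r).
      move: H'; rewrite -val_eqE /=.
      by do 2!case: ifP => //; lia.
    move: (Eij); rewrite Epat => /orP[/andP[jd /eqP ji]|/andP[di /eqP ij]].
      have id : (i < d)%N by lia.
      rewrite id -ji jd eqxx mul1r /c' id jd mulrAC.
      have sgj : sg j = (-1) ^+ j.+1 by rewrite /sg jd.
      rewrite -sgj {1}ji cE -?ji //.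
      by rewrite /gam -ji jd EnE divfK.
    rewrite -ij ltnNge di /= eqxx mul1r /c' ltnNge di /= mulrN1 mulNr -exprS.
    by rewrite (eqP (xchooseP (H i))) opprK EnE ij.
  have uQft : (Q^fr)^T \in unitmx by rewrite unitmx_tr.
  rewrite -{1}[N](mulKmx uQ) -{1}[Q *m N](mulmxK uQft) QE -CE.
  by rewrite map_mxM trmx_mul map_invmx trmx_inv !mulmxA.
have -> : (invmx Q *m C)^T *m R *m (invmx Q *m C)^fr = C^T *m R1 *m C^fr.
  by rewrite R1def map_mxM trmx_mul map_invmx trmx_inv !mulmxA.
rewrite R1E Cfr DG01E tr_diag_mx !mul_diag_mx mul_mx_diag.
apply/matrixP => i k; rewrite !mxE -!val_eqE /= -i0E /= k0E.
case: eqVneq => [ii|]; case: eqVneq => [kk|]; rewrite /= ?mulr0 ?mul0r //.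
rewrite ii kk !mulr1 /c' i0E d0 leqnn -[X in c X * _]/(i0.+1.-1) i0E mulrAC cd.
by rewrite /gam -i0E /= ltnn divfK // /sg -i0E ltnSn.
Qed.
End StandardForm.
(** * Integral matrices and their reduction *)

Section Integers.
Variables (S : WittSetting) (HS : WittAxioms S).
Local Notation L := (wL S).
Local Notation k := (wk S).
Local Notation W := (wW S).
Local Notation p := (pL S).
Local Notation red := (wred S).
Local Notation sig := (wsig S).
Local Notation sigi := (wsigi S).

Lemma sig_is_zmod_morphism : zmod_morphism sig.
Proof.
have s0 : sig 0 = 0.
  by apply: (@addIr _ (sig 0)); rewrite -wa_sigD // !add0r.
move=> x y; rewrite (wa_sigD HS); congr (_ + _).
by apply: (@addIr _ (sig y)); rewrite -wa_sigD // !addNr.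
Qed.
HB.instance Definition _ := GRing.isZmodMorphism.Build L L sig sig_is_zmod_morphism.

Lemma sig_is_monoid_morphism : monoid_morphism sig.
Proof. by split; [exact: wa_sig1 | exact: wa_sigM]. Qed.
HB.instance Definition _ :=
  GRing.isMonoidMorphism.Build L L sig sig_is_monoid_morphism.

Lemma sigi_is_zmod_morphism : zmod_morphism sigi.
Proof. exact: can2_zmod_morphism (wa_sigK HS) (wa_sigiK HS). Qed.
HB.instance Definition _ := GRing.isZmodMorphism.Build L L sigi sigi_is_zmod_morphism.

Lemma sigi_is_monoid_morphism : monoid_morphism sigi.
Proof. exact: can2_monoid_morphism (wa_sigK HS) (wa_sigiK HS). Qed.
HB.instance Definition _ :=
  GRing.isMonoidMorphism.Build L L sigi sigi_is_monoid_morphism.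

Lemma sig_p : sig p = p. Proof. exact: rmorph_nat. Qed.

Lemma W1 : W 1. Proof. exact: wa_W1. Qed.
Lemma W0 : W 0.
Proof. by rewrite -(addrN 1); apply: wa_WD => //; [|apply: wa_WN => //]; exact: W1. Qed.
Lemma WD x y : W x -> W y -> W (x + y). Proof. exact: wa_WD. Qed.
Lemma WN x : W x -> W (- x). Proof. exact: wa_WN. Qed.
Lemma WB x y : W x -> W y -> W (x - y).
Proof. by move=> *; apply: WD => //; apply: WN. Qed.
Lemma WM x y : W x -> W y -> W (x * y). Proof. exact: wa_WM. Qed.
Lemma Wp : W p. Proof. exact: wa_Wp. Qed.
Lemma WX x m : W x -> W (x ^+ m).
Proof. by move=> Wx; elim: m => [|m IH]; [exact: W1 | rewrite exprS; apply: WM]. Qed.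
Lemma W_sum I (s : seq I) (P : pred I) (f : I -> L) :
  (forall i, P i -> W (f i)) -> W (\sum_(i <- s | P i) f i).
Proof. by move=> H; apply: big_ind => //; [exact: W0 | exact: WD]. Qed.
Lemma W_prod I (s : seq I) (P : pred I) (f : I -> L) :
  (forall i, P i -> W (f i)) -> W (\prod_(i <- s | P i) f i).
Proof. by move=> H; apply: big_ind => //; [exact: W1 | exact: WM]. Qed.
Lemma W_sign m : W ((-1) ^+ m). Proof. by apply: WX; apply: WN; exact: W1. Qed.
Lemma Wsig x : W (sig x) <-> W x. Proof. exact: wa_sigW. Qed.
Lemma Wsigi x : W (sigi x) <-> W x. Proof. by rewrite -Wsig wa_sigiK. Qed.
Lemma p_neq0 : p != 0. Proof. exact: wa_p0. Qed.

Lemma redD x y : W x -> W y -> red (x + y) = red x + red y.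
Proof. exact: wa_redD. Qed.
Lemma redM x y : W x -> W y -> red (x * y) = red x * red y.
Proof. exact: wa_redM. Qed.
Lemma red1 : red 1 = 1. Proof. exact: wa_red1. Qed.
Lemma red0 : red 0 = 0.
Proof. by apply: (@addIr _ (red 0)); rewrite -redD ?add0r //; exact: W0. Qed.
Lemma redN x : W x -> red (- x) = - red x.
Proof.
move=> Wx; apply: (@addIr _ (red x)); rewrite -redD ?addNr ?red0 //; exact: WN.
Qed.
Lemma redB x y : W x -> W y -> red (x - y) = red x - red y.
Proof. by move=> Wx Wy; rewrite redD ?redN //; exact: WN. Qed.
Lemma red_sum I (s : seq I) (P : pred I) (f : I -> L) : (forall i, P i -> W (f i)) ->
  red (\sum_(i <- s | P i) f i) = \sum_(i <- s | P i) red (f i).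
Proof.
move=> H; suff [] : W (\sum_(i <- s | P i) f i) /\
  red (\sum_(i <- s | P i) f i) = \sum_(i <- s | P i) red (f i) by [].
apply: (big_ind2 (fun x y => W x /\ red x = y)).
- by split; [exact: W0 | exact: red0].
- by move=> x1 x2 y1 y2 [Wx <-] [Wy <-]; split; [exact: WD | rewrite redD].
- by move=> i Pi; split; [exact: H|].
Qed.
Lemma red_prod I (s : seq I) (P : pred I) (f : I -> L) : (forall i, P i -> W (f i)) ->
  red (\prod_(i <- s | P i) f i) = \prod_(i <- s | P i) red (f i).
Proof.
move=> H; suff [] : W (\prod_(i <- s | P i) f i) /\
  red (\prod_(i <- s | P i) f i) = \prod_(i <- s | P i) red (f i) by [].
apply: (big_ind2 (fun x y => W x /\ red x = y)).
- by split; [exact: W1 | exact: red1].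
- by move=> x1 x2 y1 y2 [Wx <-] [Wy <-]; split; [exact: WM | rewrite redM].
- by move=> i Pi; split; [exact: H|].
Qed.
Lemma red_sign m : red ((-1) ^+ m) = (-1) ^+ m.
Proof.
elim: m => [|m IH]; first by rewrite !expr0 red1.
by rewrite !exprS redM ?IH ?redN ?red1 //; [exact: W1|apply: WN; exact: W1|exact: W_sign].
Qed.
Lemma red_eq0 x : W x -> red x = 0 <-> W (x / p). Proof. exact: wa_red_ker. Qed.
Lemma red_p : red p = 0.
Proof. by apply/(red_eq0 Wp); rewrite divff ?p_neq0 //; exact: W1. Qed.
Lemma red_sig x : W x -> red (sig x) = red x ^+ wp S.
Proof. exact: wa_sig_frob. Qed.

Lemma pchar_k : wp S \in [pchar k].
Proof.
rewrite inE (wa_prime HS) /=.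
suff H m : W m%:R /\ red m%:R = m%:R by have [_ <-] := H (wp S); rewrite -/p red_p.
elim: m => [|m [IH1 IH2]]; first by split; [exact: W0 | exact: red0].
rewrite -addn1 !natrD; split; first by apply: WD => //; exact: W1.
by rewrite redD ?IH2 ?red1 //; exact: W1.
Qed.


Lemma W_inv x : W x -> red x != 0 -> W x^-1.
Proof.
move=> Wx rx.
have x0 : x != 0 by apply: contraNneq rx => ->; rewrite red0.
have [m [u [Wu WVu xE]]] := wa_dvr HS x0.
have u0 : u != 0 by apply: contraNneq x0 => u0; rewrite xE u0 mulr0.
case: m xE => [[|m]|m] xE.
- by rewrite xE expr0z mul1r.
- case/eqP: rx; apply/(red_eq0 Wx); rewrite xE -exprnP exprS.
  have -> : p * p ^+ m * u / p = p ^+ m * u by field; exact: p_neq0.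
  by apply: WM => //; apply: WX; exact: Wp.
- case: (wa_Wpinv HS); rewrite -/p.
  have -> : p^-1 = p ^+ m * (x * u^-1).
    rewrite xE NegzE -exprnN mulfK // exprS invfM mulrCA mulfV ?mulr1 //.
    by rewrite expf_neq0 // p_neq0.
  by apply: WM; [apply: WX; exact: Wp | apply: WM].
Qed.

Definition intmx m n (X : 'M[L]_(m, n)) := forall i j, W (X i j).

Lemma intmx0 m n : intmx (0 : 'M[L]_(m, n)).
Proof. by move=> i j; rewrite mxE; exact: W0. Qed.
Lemma intmx1 n : intmx (1%:M : 'M[L]_n).
Proof. by move=> i j; rewrite mxE; case: (_ == _); [exact: W1 | exact: W0]. Qed.
Lemma intmxD m n (X Y : 'M[L]_(m, n)) : intmx X -> intmx Y -> intmx (X + Y).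
Proof. by move=> HX HY i j; rewrite mxE; apply: WD. Qed.
Lemma intmxN m n (X : 'M[L]_(m, n)) : intmx X -> intmx (- X).
Proof. by move=> HX i j; rewrite mxE; apply: WN. Qed.
Lemma intmxZ m n c (X : 'M[L]_(m, n)) : W c -> intmx X -> intmx (c *: X).
Proof. by move=> Hc HX i j; rewrite mxE; apply: WM. Qed.
Lemma intmxM m n q (X : 'M[L]_(m, n)) (Y : 'M[L]_(n, q)) :
  intmx X -> intmx Y -> intmx (X *m Y).
Proof. by move=> HX HY i j; rewrite mxE; apply: W_sum => l _; apply: WM. Qed.
Lemma intmx_tr m n (X : 'M[L]_(m, n)) : intmx X -> intmx X^T.
Proof. by move=> HX i j; rewrite mxE. Qed.
Lemma intmx_sig m n (X : 'M[L]_(m, n)) : intmx X -> intmx (map_mx sig X).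
Proof. by move=> HX i j; rewrite mxE Wsig. Qed.
Lemma intmx_sigi m n (X : 'M[L]_(m, n)) : intmx X -> intmx (map_mx sigi X).
Proof. by move=> HX i j; rewrite mxE Wsigi. Qed.
Lemma intmx_delta m n i j : intmx (delta_mx i j : 'M[L]_(m, n)).
Proof. by move=> i' j'; rewrite mxE; case: (_ && _); [exact: W1 | exact: W0]. Qed.
Lemma W_det n (X : 'M[L]_n) : intmx X -> W (\det X).
Proof. by move=> HX; apply: W_sum => s _; apply: WM; [exact: W_sign | exact: W_prod]. Qed.
Lemma intmx_adj n (X : 'M[L]_n) : intmx X -> intmx (\adj X).
Proof.
move=> HX i j; rewrite mxE; apply: WM; first exact: W_sign.
by apply: W_det => i' j'; rewrite !mxE.
Qed.

Lemma redmx0 m n : map_mx red (0 : 'M[L]_(m, n)) = 0.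
Proof. by apply/matrixP => i j; rewrite !mxE red0. Qed.
Lemma redmxN m n (X : 'M[L]_(m, n)) : intmx X -> map_mx red (- X) = - map_mx red X.
Proof. by move=> HX; apply/matrixP => i j; rewrite !mxE redN. Qed.
Lemma redmxM m n q (X : 'M[L]_(m, n)) (Y : 'M[L]_(n, q)) :
  intmx X -> intmx Y -> map_mx red (X *m Y) = map_mx red X *m map_mx red Y.
Proof.
move=> HX HY; apply/matrixP => i j; rewrite !mxE red_sum => [|l _]; last exact: WM.
by apply: eq_bigr => l _; rewrite !mxE redM.
Qed.
Lemma redmx1 n : map_mx red (1%:M : 'M[L]_n) = 1%:M.
Proof. by apply/matrixP => i j; rewrite !mxE; case: (_ == _); rewrite ?red1 ?red0. Qed.
Lemma redmx_sig m n (X : 'M[L]_(m, n)) : intmx X ->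
  map_mx red (map_mx sig X) = frob_mx (map_mx red X).
Proof. by move=> HX; apply/matrixP => i j; rewrite !mxE red_sig. Qed.
Lemma red_det n (X : 'M[L]_n) : intmx X -> red (\det X) = \det (map_mx red X).
Proof.
move=> HX; rewrite red_sum => [|s _]; last first.
  by apply: WM; [exact: W_sign | exact: W_prod].
apply: eq_bigr => s _; rewrite redM ?red_sign ?red_prod //; last first.
- exact: W_prod.
- exact: W_sign.
by congr (_ * _); apply: eq_bigr => i _; rewrite mxE.
Qed.
Lemma red_adj n (X : 'M[L]_n) : intmx X -> map_mx red (\adj X) = \adj (map_mx red X).
Proof.
move=> HX; apply/matrixP => i j; rewrite !mxE redM ?red_sign; last first.
- by apply: W_det => i' j'; rewrite !mxE.
- exact: W_sign.
rewrite red_det => [|i' j']; last by rewrite !mxE.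
by congr (_ * \det _); apply/matrixP => i' j'; rewrite !mxE.
Qed.

Lemma frob_mxE m n (X : 'M[k]_(m, n)) :
  frob_mx X = map_mx (pFrobenius_aut pchar_k) X.
Proof. by apply/matrixP => i j; rewrite !mxE. Qed.

Lemma lift_mx m n (X : 'M[k]_(m, n)) :
  exists2 Y : 'M[L]_(m, n), intmx Y & map_mx red Y = X.
Proof.
have /fin_all_exists[f fE] :
    forall ij : 'I_m * 'I_n, exists x, W x /\ red x = X ij.1 ij.2.
  by move=> ij; apply: (wa_red_surj HS).
exists (\matrix_(i, j) f (i, j)); first by move=> i j; rewrite mxE; have [] := fE (i, j).
by apply/matrixP => i j; rewrite !mxE; have [] := fE (i, j).
Qed.

Lemma intmx_inv n (X : 'M[L]_n) : intmx X -> map_mx red X \in unitmx ->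
  X \in unitmx /\ intmx (invmx X).
Proof.
move=> HX; rewrite unitmxE unitfE -red_det // => rX.
have uX : X \in unitmx.
  by rewrite unitmxE unitfE; apply: contraNneq rX => ->; rewrite red0.
split=> //; rewrite /invmx uX; apply: intmxZ; last exact: intmx_adj.
by apply: W_inv => //; apply: W_det.
Qed.

Lemma redmx_inv n (X : 'M[L]_n) : intmx X -> map_mx red X \in unitmx ->
  map_mx red (invmx X) = invmx (map_mx red X).
Proof.
move=> HX uX; have [u i] := intmx_inv HX uX.
by rewrite -[LHS](mulKmx uX) -redmxM // mulmxV // redmx1 mulmx1.
Qed.

(* Th is the matrix of tau on M_0 in a basis e_1, ..., e_n whose reduction is the
   standard basis of B(d) + S^(n-d); the index j stands for e_(j+1). *)
Section Coordinates.
Variables (n d : nat) (Th : 'M[L]_n).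
Hypothesis d_gt0 : (0 < d)%N.
Hypothesis Th_p : forall i j, W (p * Th i j).
Hypothesis Th_int : forall i j : 'I_n,
  ~~ ((i == 0%N :> nat) && (j.+2 == d)) -> W (Th i j).
Hypothesis Th_row0 : forall i j : 'I_n,
  (i : nat) = 0%N -> j.+2 = d -> red (p * Th i j) = (-1) ^+ d.
Hypothesis Th_row : forall i j : 'I_n, (0 < i < d)%N -> j.+2 != d ->
  red (Th i j) = (j.+2 == i)%:R.

Definition coord_tau (z : 'rV[L]_n) : 'rV[L]_n := map_mx sig (map_mx sig z) *m Th.

(** Horner form of M_0 + ... + tau^l M_0, which makes induction on l direct. *)
Fixpoint coord_tsum (l : nat) (a : 'rV[L]_n) : Prop :=
  if l is l'.+1 then exists x z, [/\ intmx x, coord_tsum l' z & a = x + coord_tau z]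
  else intmx a.

Local Notation th := coord_tau.
Local Notation T := coord_tsum.

Lemma coord_tauD x y : th (x + y) = th x + th y.
Proof. by rewrite /th !map_mxD mulmxDl. Qed.
Lemma coord_tauZ c x : th (c *: x) = sig (sig c) *: th x.
Proof. by rewrite /th !map_mxZ scalemxAl. Qed.
Lemma coord_tauZp m x : th (p ^- m *: x) = p ^- m *: th x.
Proof. by rewrite coord_tauZ !fmorphV /= !rmorphXn /= !sig_p. Qed.
Lemma coord_tau0 : th 0 = 0. Proof. by rewrite /th !map_mx0 mul0mx. Qed.

Lemma tsum_int l a : intmx a -> T l a.
Proof.
case: l => //= l Ha; exists a, 0; split=> //; last by rewrite coord_tau0 addr0.
elim: l => [|l IH]; first exact: intmx0.
by exists 0, 0; split=> //; rewrite ?coord_tau0 ?addr0 //; exact: intmx0.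
Qed.

Lemma tsum_add l a b : T l a -> T l b -> T l (a + b).
Proof.
elim: l a b => [|l IH] a b /=; first exact: intmxD.
move=> [x [z [Hx Hz ->]]] [x' [z' [Hx' Hz' ->]]].
exists (x + x'), (z + z'); split; [exact: intmxD | exact: IH |].
by rewrite coord_tauD addrACA.
Qed.

Lemma tsum_scale l c a : W c -> T l a -> T l (c *: a).
Proof.
elim: l c a => [|l IH] c a Wc /=; first exact: intmxZ.
move=> [x [z [Hx Hz ->]]]; exists (c *: x), (sigi (sigi c) *: z); split.
- exact: intmxZ.
- by apply: IH => //; rewrite !Wsigi.
- by rewrite coord_tauZ !wa_sigiK // scalerDr.
Qed.

Lemma tsumS l a : T l a -> T l.+1 a.
Proof.
elim: l a => [|l IH] a; first exact: (@tsum_int 1).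
by move=> [x [z [Hx Hz ->]]]; exists x, z; split => //; exact: IH.
Qed.

Lemma tsum_le l l' a : (l <= l')%N -> T l a -> T l' a.
Proof.
by move=> /subnK <-; elim: (_ - _)%N => //= m IH Ha; apply: tsumS; exact: IH.
Qed.

Lemma tsum_tau l z : T l z -> T l.+1 (th z).
Proof. by move=> Hz; exists 0, z; split=> //; [exact: intmx0 | rewrite add0r]. Qed.

Lemma tsum_sum l (I : finType) (f : I -> 'rV[L]_n) :
  (forall i, T l (f i)) -> T l (\sum_i f i).
Proof.
by move=> H; apply: big_ind => //; [apply: tsum_int; exact: intmx0 | exact: tsum_add].
Qed.

(** Each application of tau costs at most one factor p, because p Th is integral. *)
Lemma tsum_bounded l a : T l a -> intmx (p ^+ l *: a).
Proof.
elim: l a => [|l IH] a; first by rewrite expr0 scale1r.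
move=> [x [z [Hx Hz ->]]]; rewrite scalerDr; apply: intmxD.
  by apply: intmxZ => //; apply: WX; exact: Wp.
move=> i j; rewrite (ord1 i) !mxE mulr_sumr; apply: W_sum => b _; rewrite !mxE.
rewrite (_ : _ * _ = sig (sig (p ^+ l * z 0 b)) * (p * Th b j)).
  apply: WM => //; rewrite !Wsig; have := IH _ Hz 0 b; by rewrite mxE.
by rewrite !rmorphM !rmorphXn /= !sig_p exprS; ring.
Qed.

(** A pole of order m with leading term e_(j+1); the error p z is allowed because the rows of Th are
    only known modulo p. *)
Definition has_pole l m (j : 'I_n) := exists2 z : 'rV[L]_n, intmx z &
  T l (p ^- m *: (delta_mx 0 j + p *: z)).

Lemma coord_tau_delta (j : 'I_n) : th (delta_mx 0 j) = row j Th.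
Proof. by rewrite /th !map_delta_mx -rowE. Qed.

(** Row 0 of Th is (-1)^d p^-1 times the basis vector of index d - 2, plus an integral row: tau
    raises the order of the pole by one. *)
Lemma has_pole_row0 l m (i j : 'I_n) : (i : nat) = 0%N -> j.+2 = d ->
  has_pole l m i -> has_pole l.+1 m.+1 j.
Proof.
move=> i0 jd [z Hz /tsum_tau Hl].
pose u := p^-1 *: ((-1) ^+ d *: (p *: row i Th) - delta_mx 0 j).
have Hu : intmx u.
  move=> o j'; rewrite !ord1 !mxE eqxx /= mulrC.
  have [->|jj] := eqVneq j' j.
    have Wa : W ((-1) ^+ d * (p * Th i j)) by apply: WM => //; exact: W_sign.
    apply/red_eq0; first by apply: WB => //; exact: W1.
    rewrite redB //; last exact: W1.
    rewrite redM //; last exact: W_sign.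
    by rewrite Th_row0 // red_sign red1 -expr2 sqrr_sign subrr.
  rewrite subr0 -mulrA mulrAC divff ?p_neq0 // mul1r.
  apply: WM; first exact: W_sign.
  by apply: Th_int; rewrite i0 /=; move: jj; rewrite -val_eqE /=; lia.
have Hpz : intmx (p *: th z).
  move=> o j'; rewrite !mxE mulr_sumr; apply: W_sum => b _.
  by rewrite !mxE mulrCA; apply: WM => //; rewrite !Wsig.
exists ((-1) ^+ d *: (p *: th z) + u).
  by apply: intmxD => //; apply: intmxZ => //; exact: W_sign.
have := tsum_scale (W_sign d) Hl.
rewrite coord_tauZp coord_tauD coord_tau_delta coord_tauZ !sig_p.
suff -> : (-1) ^+ d *: (p ^- m *: (row i Th + p *: th z)) =
  p ^- m.+1 *: (delta_mx 0 j + p *: ((-1) ^+ d *: (p *: th z) + u)) by [].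
have q0 : p ^+ m != 0 by rewrite expf_neq0 // p_neq0.
rewrite /u exprS; move: (th z) (p ^+ m) ((-1) ^+ d) p p_neq0 q0 => t q e p' p0 q0.
by apply/rowP => j'; rewrite !mxE; field; rewrite p0 q0.
Qed.

(** Modulo p, row b of Th is the basis vector of index b - 2 except in column j1 = d - 2; the pole
    assumed at j1 is there to correct that column. *)
Lemma has_pole_row l m (b j j1 : 'I_n) : b = j.+2 :> nat -> (b < d)%N -> j1.+2 = d ->
  has_pole l m b -> has_pole l.+1 m j1 -> has_pole l.+1 m j.
Proof.
move=> bj bd j1d [z Hz /tsum_tau Hl] [z1 Hz1 Hl1].
have Hpz j' : j' != j1 -> W (th z 0 j').
  move=> jj; rewrite mxE; apply: W_sum => i _; apply: WM; first by rewrite !mxE !Wsig.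
  by apply: Th_int; move: jj; rewrite -val_eqE /=; lia.
have Hpz1 j' : W (p * th z 0 j').
  rewrite !mxE mulr_sumr; apply: W_sum => i _.
  by rewrite !mxE mulrCA; apply: WM => //; rewrite !Wsig.
(* Th b j1 has no known reduction, and p tau(z) need not be divisible by p at j1; y is the whole
   coefficient there, to be subtracted. *)
pose y := Th b j1 + p * th z 0 j1.
have Wb j' : W (Th b j') by apply: Th_int; rewrite bj.
have Wy : W y by apply: WD.
pose u := p^-1 *: (row b Th + p *: th z - y *: delta_mx 0 j1 - delta_mx 0 j).
have uE (t : 'rV[L]_n) (y' : L) j' : j' != j1 ->
    (p^-1 *: (row b Th + p *: t - y' *: delta_mx 0 j1 - delta_mx 0 j)) 0 j' =
    (Th b j' - (j' == j)%:R) / p + t 0 j'.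
  by move=> jj; rewrite !mxE eqxx (negPf jj) /=; field; exact: p_neq0.
have Hu : intmx u.
  move=> o j'; rewrite !ord1; have [->|jj] := eqVneq j' j1.
    have jj1 : (j1 == j) = false by apply/negbTE; rewrite -val_eqE /=; lia.
    rewrite /u /y; move: (th z) => t.
    by rewrite !mxE !eqxx jj1 /= mulr1 subr0 addrN mulr0; exact: W0.
  rewrite /u uE //.
  apply: WD; last exact: Hpz.
  have Wn : W (j' == j)%:R by case: (_ == _); [exact: W1 | exact: W0].
  apply/red_eq0; first exact: WB.
  rewrite redB // Th_row; last by move: jj; rewrite -val_eqE /=; lia.
  rewrite bj !eqSS val_eqE; case: (_ == _); rewrite ?red1 ?red0 subrr //.
  by rewrite bd bj.
exists (u - y *: z1); first by apply: intmxD => //; apply/intmxN/intmxZ.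
have := tsum_add Hl (tsum_scale (WN Wy) Hl1).
rewrite coord_tauZp coord_tauD coord_tau_delta coord_tauZ !sig_p.
suff -> : p ^- m *: (row b Th + p *: th z) +
    - y *: (p ^- m *: (delta_mx 0 j1 + p *: z1)) =
  p ^- m *: (delta_mx 0 j + p *: (u - y *: z1)) by [].
have q0 : p ^+ m != 0 by rewrite expf_neq0 // p_neq0.
rewrite /u; move: (th z) (y) (p ^+ m) p p_neq0 q0 => t y' q p' p0 q0.
by apply/rowP => j'; rewrite !mxE; field; rewrite p0 q0.
Qed.

Lemma has_pole_chain l m i (j j1 : 'I_n) : j1.+2 = d -> has_pole l m j1 ->
  d = (j + 2 * i.+1)%N -> has_pole (l + i) m j.
Proof.
move=> j1d H1; elim: i j => [|i IH] j dE.
  by rewrite addn0 (_ : j = j1) //; apply: val_inj => /=; lia.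
have bn : (j.+2 < n)%N by have := ltn_ord j1; lia.
rewrite addnS; apply: (@has_pole_row _ _ (Ordinal bn) _ j1) => //=.
- by lia.
- by apply: IH => /=; lia.
- case: H1 => z Hz Hl; exists z => //; apply: tsum_le Hl; lia.
Qed.

Definition gap_at (e : nat) := forall l a, T l a -> T e a.

(** The poles run through d-2, d-4, ..., 0, and row 0 returns the last one to d-2 with order one
    higher; a round takes d/2 applications of tau. Elements of T_e have poles of order at most e. *)
Lemma even_no_gap e : ~~ odd d -> (d <= n)%N -> ~ gap_at e.
Proof.
move=> ed dn gap.
have n0 : (0 < n)%N by lia.
have j1n : (d.-2 < n)%N by lia.
pose i0 := Ordinal n0; pose j1 := Ordinal j1n.
have j1d : j1.+2 = d by rewrite /=; lia.
have H m : exists l, has_pole l m.+1 j1.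
  elim: m => [|m [l IH]].
    exists 1%N; apply: (@has_pole_row0 0 0 i0) => //.
    exists 0; first exact: intmx0.
    by rewrite scaler0 addr0 expr0 invr1 scale1r; exact: intmx_delta.
  exists (l + d./2.-1).+1; apply: (@has_pole_row0 _ _ i0) => //.
  by apply: (has_pole_chain j1d IH) => /=; lia.
have [l [z Hz /gap/tsum_bounded/(_ 0 j1) Wx]] := H e.
apply: (wa_Wpinv HS); rewrite -/p.
have -> : p^-1 = (p ^+ e *: (p ^- e.+1 *: (delta_mx 0 j1 + p *: z))) 0 j1 - z 0 j1.
  by rewrite !mxE !eqxx exprS /=; field; rewrite p_neq0 expf_neq0 // p_neq0.
exact: WB.
Qed.

Section OddChain.
Variable s : nat.
Hypotheses (dE : d = (2 * s + 1)%N) (dn : (d <= n)%N).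

(* The j with p^-1 e_(j+1) in M_0 + ... + tau^i M_0. *)
Definition pole_ok i (j : nat) := [&& odd j, j < d & d <= j + 2 * i]%N.

(** Poles stay at odd indices, so they never meet row 0, the only row of Th with a denominator. Row
    b sends a pole to b - 2 or d - 2, and row 1 only to d - 2, so the order remains one. *)
Lemma tsum_poles l a : T l a -> forall j,
  W (p * a 0 j) /\ (~~ pole_ok l j -> W (a 0 j)).
Proof.
elim: l a => [|l IH] a.
  by move=> Ha j; split=> //; apply: WM => //; exact: Wp.
move=> [x [z [Hx Hz ->]]] j.
suff: W (p * th z 0 j) /\ (~~ pole_ok l.+1 j -> W (th z 0 j)).
  move=> [H1 H2]; split=> [|H]; rewrite mxE ?mulrDr; apply: WD => //.
  - by apply: WM => //; exact: Wp.
  - exact: H2.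
split=> [|jl]; rewrite mxE ?mulr_sumr; apply: W_sum => b _; rewrite !mxE;
  have [Hb1 Hb2] := IH _ Hz b; case: (boolP (pole_ok l b)) => bl.
- rewrite mulrA (_ : p * _ = sig (sig (p * z 0 b))); last first.
    by rewrite !rmorphM /= !sig_p.
  apply: WM; first by rewrite !Wsig.
  by apply: Th_int; move: bl; rewrite /pole_ok; case: (b : nat); lia.
- by rewrite mulrCA; apply: WM => //; rewrite !Wsig; exact: Hb2.
- rewrite (_ : _ * _ = sig (sig (p * z 0 b)) * (Th b j / p)); last first.
    by rewrite !rmorphM /= !sig_p; field; exact: p_neq0.
  apply: WM; first by rewrite !Wsig.
  have Wb : W (Th b j).
    by apply: Th_int; move: bl; rewrite /pole_ok; case: (b : nat); lia.
  apply/red_eq0 => //; move: jl bl; rewrite /pole_ok => jl bl.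
  rewrite Th_row; [|by move: bl; case: (b : nat); lia|by lia].
  by rewrite (_ : (_ == _) = false) //; lia.
- apply: WM; first by rewrite !Wsig; exact: Hb2.
  by apply: Th_int; move: jl; rewrite /pole_ok; lia.
Qed.

(** For a pole of order one the error p^-1 (p z) is integral and can be subtracted, leaving the
    exact vector. *)
Lemma tsum_pole i (j : 'I_n) : pole_ok i j -> T i (p^-1 *: delta_mx 0 j).
Proof.
move=> /and3P[oj jd dji].
have n0 : (0 < n)%N by lia.
have j1n : (d.-2 < n)%N by lia.
pose i0 := Ordinal n0; pose j1 := Ordinal j1n.
have j1d : j1.+2 = d by rewrite /=; lia.
have H1 : has_pole 1 1 j1.
  apply: (@has_pole_row0 0 0 i0) => //.
  exists 0; first exact: intmx0.
  by rewrite scaler0 addr0 expr0 invr1 scale1r; exact: intmx_delta.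
have [|z Hz Hl] := has_pole_chain (i := (d - j)./2.-1) (j := j) j1d H1; first by lia.
have {}Hl : T i (p^- 1 *: (delta_mx 0 j + p *: z)) by apply: tsum_le Hl; lia.
have -> : p^-1 *: delta_mx 0 j = p^-1 *: (delta_mx 0 j + p *: z) + (- 1) *: z.
  by rewrite scalerDr scalerA mulVf ?p_neq0 // scale1r scaleN1r addrK.
apply: tsum_add; first by rewrite expr1 in Hl.
by rewrite scaleN1r; apply: tsum_int; exact: intmxN.
Qed.

(** An odd j is at least 1, so [pole_ok] s already admits every odd j < d = 2s + 1, and no later
    step can add another. *)
Lemma odd_gap : gap_at s.
Proof.
move=> l a Ha; have -> : a = \sum_j a 0 j *: delta_mx 0 j.
  exact: row_sum_delta.
apply: tsum_sum => j; have [H1 H2] := tsum_poles Ha j.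
have [jl|jl] := boolP (pole_ok l j); last first.
  by apply: tsum_int; apply: intmxZ; [exact: H2 | exact: intmx_delta].
have -> : a 0 j *: delta_mx 0 j = (p * a 0 j) *: (p^-1 *: delta_mx 0 j) :> 'rV[L]_n.
  by rewrite scalerA mulrAC mulfV ?p_neq0 // mul1r.
apply: tsum_scale => //; apply: tsum_pole; move: jl; rewrite /pole_ok; lia.
Qed.

Lemma odd_gap_min e : (e < s)%N -> ~ gap_at e.
Proof.
move=> es gap.
(* This is the pole that appears exactly at step e + 1; its index is positive because e < s. *)
have jn : ((d - 2 * e.+1) < n)%N by lia.
have /gap/tsum_poles/(_ (Ordinal jn))[_] : T e.+1 (p^-1 *: delta_mx 0 (Ordinal jn)).
  by apply: tsum_pole; rewrite /pole_ok /=; lia.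
rewrite !mxE !eqxx mulr1 => H; apply: (wa_Wpinv HS); apply: H.
by rewrite /pole_ok /=; lia.
Qed.
End OddChain.

End Coordinates.

(** * Lattices through transition matrices *)

Lemma latP n (B : 'M[L]_n) x : lat_of B x <-> intmx (x *m invmx B).
Proof. by split=> [H i j|H i]; [rewrite ord1 | exact: H]. Qed.

Lemma intmx_rows m n (X : 'M[L]_(m, n)) : (forall i, intmx (row i X)) -> intmx X.
Proof. by move=> H i j; have := H i 0 j; rewrite mxE. Qed.

Lemma intmx_row m n i (X : 'M[L]_(m, n)) : intmx X -> intmx (row i X).
Proof. by move=> H i' j; rewrite mxE. Qed.

Lemma lat_of_row n (B : 'M[L]_n) i : B \in unitmx -> lat_of B (row i B).
Proof. by move=> uB; apply/latP; rewrite -row_mul mulmxV //; apply/intmx_row/intmx1. Qed.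

Lemma lat_sub n (B B' : 'M[L]_n) : B \in unitmx ->
  (forall x, lat_of B x -> lat_of B' x) -> intmx (B *m invmx B').
Proof.
by move=> uB H; apply: intmx_rows => i; rewrite row_mul; apply/latP/H/lat_of_row.
Qed.

Lemma unitmx_block_diag (F : fieldType) n (B0 B1 : 'M[F]_n) :
  (block_mx B0 0 0 B1 \in unitmx) = (B0 \in unitmx) && (B1 \in unitmx).
Proof. by rewrite unitmxE det_lblock unitrM -!unitmxE. Qed.

Lemma inv_block_diag n (B0 B1 : 'M[L]_n) : B0 \in unitmx -> B1 \in unitmx ->
  invmx (block_mx B0 0 0 B1) = block_mx (invmx B0) 0 0 (invmx B1).
Proof.
move=> u0 u1; have u : block_mx B0 0 0 B1 \in unitmx.
  by rewrite unitmx_block_diag u0.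
rewrite -[RHS](mulKmx u) mulmx_block !mulmx0 !mul0mx !addr0 !add0r !mulmxV //.
by rewrite -scalar_mx_block mulmx1.
Qed.

(** * Graded bases of unitary Dieudonne modules *)

Section Isocrystal.
Variables (n : nat) (A J : 'M[L]_(n + n)).
Hypothesis HI : IsoAxioms A J.
Local Notation A01 := (ursubmx A).
Local Notation A10 := (dlsubmx A).
Local Notation J01 := (ursubmx J).

Lemma AE : A = block_mx 0 A01 A10 0.
Proof. by rewrite -{1}[A]submxK (ia_A00 HI) (ia_A11 HI). Qed.

Lemma JE : J = block_mx 0 J01 (- J01^T) 0.
Proof.
have -> : - J01^T = dlsubmx J.
  by rewrite trmx_ursub (ia_Jalt HI); apply/matrixP => i j; rewrite !mxE opprK.
by rewrite -{1}[J]submxK (ia_J00 HI) (ia_J11 HI).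
Qed.

Lemma sA_block : map_mx sig A01 *m A10 = p%:M /\ map_mx sig A10 *m A01 = p%:M.
Proof.
have := ia_F2 HI; rewrite [X in map_mx _ X *m X]AE map_block_mx mulmx_block.
rewrite scalar_mx_block !map_mx0 !mul0mx !mulmx0 !add0r !addr0.
by case/eq_block_mx => -> _ _ ->.
Qed.

Lemma mul_pC (X Y : 'M[L]_n) : X *m Y = p%:M -> Y *m X = p%:M.
Proof.
move=> XY; have : (p^-1 *: X) *m Y = 1%:M.
  by rewrite -scalemxAl XY scale_scalar_mx mulVf ?p_neq0.
move/mulmx1C; rewrite -scalemxAr => /(congr1 (fun Z => p *: Z)).
by rewrite scalerA mulfV ?p_neq0 // scale1r scale_scalar_mx mulr1.
Qed.

Lemma mulp_unit (X Y : 'M[L]_n) : X *m Y = p%:M -> X \in unitmx.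
Proof.
move=> XY; have /mulmx1_unit[] : X *m (p^-1 *: Y) = 1%:M => //.
by rewrite -scalemxAr XY scale_scalar_mx mulVf ?p_neq0.
Qed.

Lemma sigmxK m q (X : 'M[L]_(m, q)) : map_mx sigi (map_mx sig X) = X.
Proof. by apply/matrixP => i j; rewrite !mxE wa_sigK. Qed.
Lemma sigimxK m q (X : 'M[L]_(m, q)) : map_mx sig (map_mx sigi X) = X.
Proof. by apply/matrixP => i j; rewrite !mxE wa_sigiK. Qed.

(** Both sides are p times the inverse of sigma(A01). *)
Lemma ssA10 : map_mx sig (map_mx sig A10) = A10.
Proof.
have [E1 E2] := sA_block.
have u : map_mx sig A01 \in unitmx by apply: mulp_unit E1.
apply: (can_inj (mulmxK u)); rewrite (mul_pC E1) -map_mxM E2 map_scalar_mx.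
by rewrite /= sig_p.
Qed.

Lemma tauE x : tau A x = map_mx sig (map_mx sig x).
Proof.
rewrite /tau /Fop map_mxM -mulmxA (ia_F2 HI) mul_mx_scalar scalerA mulVf ?p_neq0 //.
by rewrite scale1r.
Qed.

(** In a graded basis, the suffix 01 marks the block of F or V from degree 0 to degree 1, and 10 the
    opposite one. *)
Definition CF01 (B0 B1 : 'M[L]_n) := map_mx sig B0 *m A01 *m invmx B1.
Definition CF10 (B0 B1 : 'M[L]_n) := map_mx sig B1 *m A10 *m invmx B0.
Definition CV01 (B0 B1 : 'M[L]_n) := map_mx sigi B0 *m A01 *m invmx B1.
Definition CV10 (B0 B1 : 'M[L]_n) := map_mx sigi B1 *m A10 *m invmx B0.

Lemma CF_block B0 B1 : B0 \in unitmx -> B1 \in unitmx ->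
  map_mx sig (block_mx B0 0 0 B1) *m A *m invmx (block_mx B0 0 0 B1) =
  block_mx 0 (CF01 B0 B1) (CF10 B0 B1) 0.
Proof.
move=> u0 u1; rewrite inv_block_diag // {1}AE map_block_mx !mulmx_block !map_mx0.
by rewrite !mul0mx !mulmx0 !add0r !addr0 !mul0mx.
Qed.

Lemma CV_block B0 B1 : B0 \in unitmx -> B1 \in unitmx ->
  map_mx sigi (block_mx B0 0 0 B1) *m A *m invmx (block_mx B0 0 0 B1) =
  block_mx 0 (CV01 B0 B1) (CV10 B0 B1) 0.
Proof.
move=> u0 u1; rewrite inv_block_diag // {1}AE map_block_mx !mulmx_block !map_mx0.
by rewrite !mul0mx !mulmx0 !add0r !addr0 !mul0mx.
Qed.

Lemma CV10_CF01 B0 B1 : B0 \in unitmx -> B1 \in unitmx ->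
  map_mx sig (CV10 B0 B1) *m CF01 B0 B1 = p%:M.
Proof.
move=> u0 u1; rewrite /CV10 /CV01 /CF01 /CF10 !map_mxM map_invmx sigimxK.
rewrite -!mulmxA mulKmx ?map_unitmx //.
by rewrite [map_mx _ _ *m (_ *m _)]mulmxA (sA_block).2 mul_scalar_mx -scalemxAr mulmxV //
  scale_scalar_mx mulr1.
Qed.

Lemma CV01_CF10 B0 B1 : B0 \in unitmx -> B1 \in unitmx ->
  map_mx sig (CV01 B0 B1) *m CF10 B0 B1 = p%:M.
Proof.
move=> u0 u1; rewrite /CV10 /CV01 /CF01 /CF10 !map_mxM map_invmx sigimxK.
rewrite -!mulmxA mulKmx ?map_unitmx //.
by rewrite [map_mx _ _ *m (_ *m _)]mulmxA (sA_block).1 mul_scalar_mx -scalemxAr mulmxV //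
  scale_scalar_mx mulr1.
Qed.

(** The relation p tau = F^2 on degree 0; it determines p Th modulo p. *)
Lemma theta_CF B0 B1 : B0 \in unitmx -> B1 \in unitmx ->
  p *: (map_mx sig (map_mx sig B0) *m invmx B0) =
  map_mx sig (CF01 B0 B1) *m CF10 B0 B1.
Proof.
move=> u0 u1; rewrite /CF01 /CF10 !map_mxM map_invmx.
rewrite -!mulmxA mulKmx ?map_unitmx //.
by rewrite [map_mx sig A01 *m _]mulmxA (sA_block).1 mul_scalar_mx -scalemxAr.
Qed.

(** The relation tau V = F on degree 1, from F V = p; it determines rows of Th modulo p without
    dividing by p. *)
Lemma theta_CV B0 B1 : B0 \in unitmx -> B1 \in unitmx ->
  map_mx sig (map_mx sig (CV10 B0 B1)) *m
    (map_mx sig (map_mx sig B0) *m invmx B0) = CF10 B0 B1.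
Proof.
move=> u0 u1; rewrite /CV10 /CF10 !map_mxM !map_invmx sigimxK ssA10 -!mulmxA.
by rewrite mulKmx ?map_unitmx // mulmxA.
Qed.

Variable M : 'rV[L]_(n + n) -> Prop.

Definition graded_basis (B0 B1 : 'M[L]_n) := [/\ B0 \in unitmx, B1 \in unitmx &
  forall x, M x <-> intmx (lsubmx x *m invmx B0) /\ intmx (rsubmx x *m invmx B1)].

Lemma graded_basisP B0 B1 : B0 \in unitmx -> B1 \in unitmx ->
  (forall x, M x <-> lat_of (block_mx B0 0 0 B1) x) <-> graded_basis B0 B1.
Proof.
move=> u0 u1.
have H x : lat_of (block_mx B0 0 0 B1) x <->
    intmx (lsubmx x *m invmx B0) /\ intmx (rsubmx x *m invmx B1).
  rewrite latP inv_block_diag // -{1}[x]hsubmxK mul_row_block !mulmx0 addr0 add0r.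
  split=> [Hx|[H0 H1] i j].
    split=> i j; first by have := Hx i (lshift n j); rewrite row_mxEl.
    by have := Hx i (rshift n j); rewrite row_mxEr.
  by case: (split_ordP j) => j' ->; rewrite ?row_mxEl ?row_mxEr.
split=> [HM|[_ _ HM] x]; first by split=> // x; rewrite HM H.
by rewrite HM H.
Qed.

Lemma graded_rebase B0 B1 U0 U1 : graded_basis B0 B1 ->
  U0 \in unitmx -> U1 \in unitmx -> intmx U0 -> intmx U1 ->
  intmx (invmx U0) -> intmx (invmx U1) -> graded_basis (U0 *m B0) (U1 *m B1).
Proof.
move=> [u0 u1 HM] uU0 uU1 i0 i1 j0 j1; split; rewrite ?unitmx_mul ?uU0 ?uU1 //.
move=> x; rewrite HM.
rewrite !invmx_mulmx // !mulmxA; split=> -[H0 H1]; split.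
- exact: intmxM.
- exact: intmxM.
- by have := intmxM H0 i0; rewrite mulmxKV.
- by have := intmxM H1 i1; rewrite mulmxKV.
Qed.

Section Basis.
Variables B0 B1 : 'M[L]_n.
Hypothesis HB : graded_basis B0 B1.

Let u0 : B0 \in unitmx. Proof. by case: HB. Qed.
Let u1 : B1 \in unitmx. Proof. by case: HB. Qed.

Lemma basis_row0 i : M (row_mx (row i B0) 0).
Proof.
case: HB => _ _ ->; rewrite row_mxKl row_mxKr mul0mx; split; last exact: intmx0.
by rewrite -row_mul mulmxV //; apply/intmx_row/intmx1.
Qed.

Lemma basis_row1 i : M (row_mx 0 (row i B1)).
Proof.
case: HB => _ _ ->; rewrite row_mxKl row_mxKr mul0mx; split; first exact: intmx0.
by rewrite -row_mul mulmxV //; apply/intmx_row/intmx1.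
Qed.

(** f is sigma for F and its inverse for V. *)
Lemma basis_stable (f : L -> L) : f 0 = 0 ->
  (forall x, M x -> M (map_mx f x *m A)) ->
  intmx (map_mx f B0 *m A01 *m invmx B1) /\ intmx (map_mx f B1 *m A10 *m invmx B0).
Proof.
move=> f0 HF; have fmx0 : map_mx f (0 : 'rV[L]_n) = 0.
  by apply/matrixP => i j; rewrite !mxE.
split; apply: intmx_rows => i; rewrite !row_mul -map_row.
  have := HF _ (basis_row0 i); rewrite map_row_mx fmx0 {1}AE mul_row_block.
  rewrite !(mul0mx, mulmx0, add0r, addr0); case: HB => _ _ -> [].
  by rewrite row_mxKr.
have := HF _ (basis_row1 i); rewrite map_row_mx fmx0 {1}AE mul_row_block.
rewrite !(mul0mx, mulmx0, add0r, addr0); case: HB => _ _ -> [].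
by rewrite row_mxKl.
Qed.

Local Notation Th := (map_mx sig (map_mx sig B0) *m invmx B0).

Lemma tsum0P (P : 'rV[L]_(n + n) -> Prop) y : tsum A P 0 y <-> P y.
Proof.
split=> [[xs [H ->]]|Hy]; first by rewrite big_ord1; exact: H.
by exists (fun=> y); split=> //; rewrite big_ord1.
Qed.

Lemma tau_add x y : tau A (x + y) = tau A x + tau A y.
Proof. by rewrite !tauE !map_mxD. Qed.

Lemma tau_zero : tau A 0 = 0. Proof. by rewrite tauE !map_mx0. Qed.

Lemma tsumSP (P : 'rV[L]_(n + n) -> Prop) l y :
  tsum A P l.+1 y <-> exists x z, [/\ P x, tsum A P l z & y = x + tau A z].
Proof.
have tau_sum (I : finType) (f : I -> 'rV[L]_(n + n)) :
    tau A (\sum_i f i) = \sum_i tau A (f i) by apply: (big_morph _ tau_add tau_zero).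
split=> [[xs [H ->]]|[x [z [Hx [xs [H ->]] ->]]]].
  exists (xs ord0), (\sum_(i < l.+1) iter i (tau A) (xs (lift ord0 i))); split=> //.
    by exists (fun i => xs (lift ord0 i)).
  by rewrite big_ord_recl tau_sum.
exists (fun i => if unlift ord0 i is Some j then xs j else x); split.
  by move=> i; case: unliftP.
rewrite [RHS]big_ord_recl /=.
rewrite unlift_none tau_sum; congr (_ + _).
by apply: eq_bigr => i _; rewrite liftK.
Qed.

Lemma deg0P x : deg0 M x <-> rsubmx x = 0 /\ intmx (lsubmx x *m invmx B0).
Proof.
rewrite /deg0; case: HB => _ _ ->; split=> [[[H _] r]|[r H]] //.
by rewrite r mul0mx; do !split=> //; exact: intmx0.
Qed.

Lemma tsum_coordP l y : tsum A (deg0 M) l y <->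
  rsubmx y = 0 /\ coord_tsum Th l (lsubmx y *m invmx B0).
Proof.
elim: l y => [|l IH] y; first by rewrite tsum0P deg0P.
have tauE' z : lsubmx (tau A z) *m invmx B0 = coord_tau Th (lsubmx z *m invmx B0).
  rewrite tauE /coord_tau !map_mxM !map_invmx -!mulmxA mulKmx ?map_unitmx //.
  by rewrite -!map_lsubmx.
rewrite tsumSP; split=> [[x [z [/deg0P[rx ix] /IH[rz Tz] ->]]]|[ry]].
  split; first by rewrite linearD /= rx tauE -!map_rsubmx rz !map_mx0 add0r.
  exists (lsubmx x *m invmx B0), (lsubmx z *m invmx B0); split=> //.
  by rewrite linearD mulmxDl tauE'.
move=> [x [z [ix Tz yE]]].
exists (row_mx (x *m B0) 0), (row_mx (z *m B0) 0); split.
- by apply/deg0P; rewrite row_mxKl row_mxKr mulmxK.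
- by apply/IH; rewrite row_mxKl row_mxKr mulmxK.
- rewrite -[y]hsubmxK ry -[lsubmx y](mulmxKV u0) yE.
  rewrite -[tau A _]hsubmxK tauE -!map_rsubmx row_mxKr !map_mx0 add_row_mx addr0.
  congr row_mx; rewrite mulmxDl; congr (_ + _).
  by rewrite /coord_tau mulmxA mulmxKV // -!map_lsubmx row_mxKl !map_mxM.
Qed.

(** M is graded and tau acts coordinatewise, so projecting each summand to degree 0 commutes with
    forming the sums. *)
Lemma Lambda_coordP y : deg0 (Lambda_plus A M) y <->
  rsubmx y = 0 /\ exists l, coord_tsum Th l (lsubmx y *m invmx B0).
Proof.
have proj l z : tsum A M l z -> tsum A (deg0 M) l (row_mx (lsubmx z) 0).
  have projM x : M x -> deg0 M (row_mx (lsubmx x) 0).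
    by move=> Mx; apply/deg0P; rewrite row_mxKl row_mxKr; case: HB Mx => _ _ -> [].
  elim: l z => [|l IH] z; first by rewrite !tsum0P; exact: projM.
  move=> /tsumSP[x [w [Mx Tw ->]]]; apply/tsumSP.
  exists (row_mx (lsubmx x) 0), (row_mx (lsubmx w) 0); split.
  - exact: projM.
  - exact: IH.
  - by rewrite !tauE !map_row_mx !map_mx0 add_row_mx addr0 linearD /= -!map_lsubmx.
split=> [[[l Tl] ry]|[ry [l Tl]]].
  split=> //; exists l; move/proj/tsum_coordP: Tl => [_].
  by rewrite row_mxKl.
split=> //; exists l.
have /tsum_coordP[xs [H ->]] : rsubmx y = 0 /\ coord_tsum Th l (lsubmx y *m invmx B0).
  by [].
by exists xs; split=> // i; have [] := H i.
Qed.

Lemma gap_okP e : gap_ok A M e <-> gap_at Th e.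
Proof.
split=> [gap l a Ta|gap y].
  have /Lambda_coordP/gap/tsum_coordP[_] :
      rsubmx (row_mx (a *m B0) 0 : 'rV[L]_(n + n)) = 0 /\
      exists l, coord_tsum Th l (lsubmx (row_mx (a *m B0) 0 : 'rV[L]_(n + n)) *m invmx B0).
    by rewrite row_mxKl row_mxKr mulmxK //; split=> //; exists l.
  by rewrite row_mxKl mulmxK.
rewrite Lambda_coordP tsum_coordP; split=> [[ry [l Tl]]|[ry Te]]; split=> //.
  exact: gap Tl.
by exists e.
Qed.

End Basis.

Lemma frob_sign m : ((-1) ^+ m : k) ^+ wp S = (-1) ^+ m.
Proof.
have op : odd (wp S) by case: (even_prime (wa_prime HS)) (wa_odd HS) => [->|].
by rewrite -exprM -[LHS]signr_odd oddM op andbT signr_odd.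
Qed.

Lemma frob_const m q (X : 'M[k]_(m, q)) :
  (forall i j, X i j ^+ wp S = X i j) -> frob_mx X = X.
Proof. by move=> H; apply/matrixP => i j; rewrite mxE H. Qed.

Let wp_gt0 : (0 < wp S)%N. Proof. exact: prime_gt0 (wa_prime HS). Qed.

Lemma frob_DF01 d : frob_mx (DF01 k n d) = DF01 k n d.
Proof.
apply: frob_const => i j; rewrite mxE; case: ifP => _; first exact: frob_sign.
by rewrite expr0n eqn0Ngt wp_gt0.
Qed.

Lemma frob_DV10 d : frob_mx (DV10 k n d) = DV10 k n d.
Proof.
apply: frob_const => i j; rewrite mxE.
by do 2!case: ifP => _; rewrite ?expr1n // expr0n eqn0Ngt wp_gt0.
Qed.

Lemma frob_DV01 d : frob_mx (DV01 k n d) = DV01 k n d.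
Proof.
apply: frob_const => i j; rewrite mxE.
by case: ifP => _; rewrite ?expr1n // expr0n eqn0Ngt wp_gt0.
Qed.

Lemma frob_DG01 d : frob_mx (DG01 k n d) = DG01 k n d.
Proof.
apply: frob_const => i j; rewrite mxE.
do 2?case: ifP => _; rewrite ?frob_sign //; first exact: (frob_sign 1).
by rewrite expr0n eqn0Ngt wp_gt0.
Qed.

(** The only nonzero path of F^2 from degree 0 is e_1 to (-1)^d f_d to (-1)^d e_(d-1). *)
Lemma DF01_DF10 d i j : (0 < d <= n)%N -> (DF01 k n d *m DF10 k n d) i j =
  if (i == 0%N :> nat) && (j.+2 == d) then (-1) ^+ d else 0.
Proof.
move=> /andP[d0 dn]; have ln : (d.-1 < n)%N by lia.
rewrite mxE (bigD1 (Ordinal ln)) //= big1 => [|l]; last first.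
  rewrite -val_eqE /= => ll; rewrite !mxE (negPf ll) andbF mul0r //.
rewrite !mxE /= eqxx andbT addr0 prednK // leqnn.
case: eqP => _ /=; last by rewrite mul0r.
have -> : (0 < d.-1)%N && (j == d.-1.-1 :> nat) = (j.+2 == d) by lia.
by case: eqP; rewrite ?mulr1 ?mulr0.
Qed.

(** * The matrix of tau from F and V modulo p *)

Section Theta.
Variables (B0 B1 : 'M[L]_n) (d : nat).
Hypotheses (u0 : B0 \in unitmx) (u1 : B1 \in unitmx) (dn : (0 < d <= n)%N).
Hypotheses (i01 : intmx (CF01 B0 B1)) (i10 : intmx (CF10 B0 B1)).
Hypothesis iV : intmx (CV10 B0 B1).
Hypothesis r01 : map_mx red (CF01 B0 B1) = DF01 k n d.
Hypothesis r10 : map_mx red (CF10 B0 B1) = DF10 k n d.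
Hypothesis rV : map_mx red (CV10 B0 B1) = DV10 k n d.
Local Notation Th := (map_mx sig (map_mx sig B0) *m invmx B0).

Lemma theta_p i j : W (p * Th i j) /\ red (p * Th i j) =
  if (i == 0%N :> nat) && (j.+2 == d) then (-1) ^+ d else 0.
Proof.
have iF := intmx_sig i01.
have -> : p * Th i j = (map_mx sig (CF01 B0 B1) *m CF10 B0 B1) i j.
  by rewrite -theta_CF // [RHS]mxE.
split; first exact: intmxM.
rewrite -DF01_DF10 // -frob_DF01 -r01 -r10 -redmx_sig // -redmxM //.
by rewrite [RHS]mxE.
Qed.

Lemma theta_int (i j : 'I_n) :
  ~~ ((i == 0%N :> nat) && (j.+2 == d)) -> W (Th i j).
Proof.
move=> ij; have [Wx] := theta_p i j; rewrite (negPf ij) => /(red_eq0 Wx).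
by rewrite mulrAC divff ?p_neq0 // mul1r.
Qed.

(** Modulo p, e_(b+1) = V f_b, so tau e_(b+1) = F f_b = e_(b-1). Column d - 2 is excluded because
    row 0 of Th may have a pole there, which could turn entries of V divisible by p into units. *)
Lemma theta_row (i j : 'I_n) : (0 < i < d)%N -> j.+2 != d ->
  red (Th i j) = (j.+2 == i)%:R.
Proof.
move=> /andP[i0 id] jd; have i'n : (i.-1 < n)%N by have := ltn_ord i; lia.
pose i' := Ordinal i'n.
have WT l : W (Th l j) by apply: theta_int; rewrite (negPf jd) andbF.
have iV2 := intmx_sig (intmx_sig iV).
have rV2 : map_mx red (map_mx sig (map_mx sig (CV10 B0 B1))) = DV10 k n d.
  by rewrite redmx_sig ?redmx_sig ?rV ?frob_DV10 //; exact: intmx_sig.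
have := congr1 (fun X : 'M[L]_n => red (X i' j)) (theta_CV u0 u1).
rewrite [X in red X = _]mxE red_sum => [|l _]; last exact: WM.
rewrite (bigD1 i) //= big1 => [|l li]; last first.
  rewrite redM //; have -> : red (map_mx sig (map_mx sig (CV10 B0 B1)) i' l) = 0.
    move/matrixP/(_ i' l): rV2; rewrite [LHS]mxE => ->; rewrite mxE /=.
    by move: li; rewrite -val_eqE /= => li; do 2!case: ifP => //; lia.
  by rewrite mul0r.
rewrite addr0 redM //.
have -> : red (map_mx sig (map_mx sig (CV10 B0 B1)) i' i) = 1.
  move/matrixP/(_ i' i): rV2; rewrite [LHS]mxE => ->; rewrite mxE /=.
  by do 2!case: ifP => //; lia.
rewrite mul1r => ->; move/matrixP/(_ i' j): r10; rewrite [LHS]mxE => ->.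
rewrite mxE /=; have -> : (i.-1 < d)%N by lia.
have -> : (0 < i.-1)%N && (j == i.-1.-1 :> nat) = (j.+2 == i) by lia.
by case: eqP.
Qed.

Lemma theta_odd_gap s : graded_basis B0 B1 -> d = (2 * s + 1)%N ->
  superspecial_gap A M s.
Proof.
move=> HB ds; have [d0 dn'] := andP dn.
have H1 i j := (theta_p i j).1.
have H3 (i j : 'I_n) : (i : nat) = 0%N -> j.+2 = d -> red (p * Th i j) = (-1) ^+ d.
  by move=> i0 jd; rewrite (theta_p i j).2 i0 jd !eqxx.
split; first by apply/(gap_okP HB)/(odd_gap d0 H1 theta_int H3 theta_row ds dn').
move=> e es /(gap_okP HB).
exact: (odd_gap_min d0 H1 theta_int H3 theta_row ds dn' es).
Qed.

Lemma theta_even_no_gap s : graded_basis B0 B1 -> ~~ odd d ->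
  ~ superspecial_gap A M s.
Proof.
move=> HB ds [/(gap_okP HB) gap _]; have [d0 dn'] := andP dn.
have H1 i j := (theta_p i j).1.
have H3 (i j : 'I_n) : (i : nat) = 0%N -> j.+2 = d -> red (p * Th i j) = (-1) ^+ d.
  by move=> i0 jd; rewrite (theta_p i j).2 i0 jd !eqxx.
exact: (even_no_gap d0 H1 theta_int H3 theta_row ds dn' gap).
Qed.
End Theta.

(* [EO_stratum] with the length 2s+1 of the chain replaced by an arbitrary d. *)
Definition EO_space (d : nat) : Prop :=
  exists (c : L) (B0 B1 : 'M[L]_n) (P0 P1 : 'M[k]_n),
    let B := block_mx B0 0 0 B1 in
    let P := block_mx P0 0 0 P1 in
    let CF := map_mx sig B *m A *m invmx B in
    let CV := map_mx sigi B *m A *m invmx B in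
    let G := c^-1 *: (B *m J *m B^T) in
    [/\ c != 0, sig c = c, self_dual J c M,
        B \in unitmx & forall x, M x <-> lat_of B x] /\
    [/\ P \in unitmx,
        map_mx red CF *m P = frob_mx P *m DF k n d,
        frob_mx (map_mx red CV *m P) = P *m frob_mx (DV k n d)
      & map_mx red G = P *m DG k n d *m P^T].

Lemma frob_block m q m' q' (X : 'M[k]_(m, q)) (Y : 'M[k]_(m, q')) (Z : 'M[k]_(m', q))
    (T : 'M[k]_(m', q')) :
  frob_mx (block_mx X Y Z T) = block_mx (frob_mx X) (frob_mx Y) (frob_mx Z) (frob_mx T).
Proof. exact: map_block_mx. Qed.

Lemma frob_mx0 m q : frob_mx (0 : 'M[k]_(m, q)) = 0.
Proof. by rewrite frob_mxE map_mx0. Qed.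

(** Lifting P to W and changing basis by the inverse lift makes the reductions equal to the standard
    matrices, not just conjugate to them. *)
Lemma EO_space_basis d : unitary_dieudonne A J M -> EO_space d ->
  exists B0 B1, [/\ graded_basis B0 B1,
    [/\ intmx (CF01 B0 B1), intmx (CF10 B0 B1) & intmx (CV10 B0 B1)] &
    [/\ map_mx red (CF01 B0 B1) = DF01 k n d, map_mx red (CF10 B0 B1) = DF10 k n d
      & map_mx red (CV10 B0 B1) = DV10 k n d]].
Proof.
move=> [_ [HF [HV _]]] [c [B0 [B1 [P0 [P1 []]]]]].
move=> [_ _ _ +] + [+ + + _]; rewrite !unitmx_block_diag.
move=> /andP[u0 u1] /(graded_basisP u0 u1) HB /andP[v0 v1].
rewrite /DF /DV CF_block // CV_block // !map_block_mx !redmx0.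
rewrite !frob_block !mulmx_block frob_block.
rewrite !frob_mx0 !(mul0mx, mulmx0, add0r, addr0).
move=> /eq_block_mx[_ F01 F10 _] /eq_block_mx[_ _ V10 _].
have [i01 i10] := basis_stable HB (rmorph0 _) HF.
have [_ iV] := basis_stable HB (rmorph0 _) HV.
have [Q0 iQ0 Q0E] := lift_mx P0; have [Q1 iQ1 Q1E] := lift_mx P1.
rewrite -Q0E in v0; rewrite -Q1E in v1.
have [w0 iV0] := intmx_inv iQ0 v0; have [w1 iV1] := intmx_inv iQ1 v1.
have HB' : graded_basis (invmx Q0 *m B0) (invmx Q1 *m B1).
  by apply: graded_rebase => //; rewrite ?unitmx_inv ?invmxK.
exists (invmx Q0 *m B0), (invmx Q1 *m B1).
have [i01' i10'] := basis_stable HB' (rmorph0 _) HF.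
have [_ iV'] := basis_stable HB' (rmorph0 _) HV.
have inv (U B : 'M[L]_n) : U \in unitmx -> B \in unitmx ->
    invmx (invmx U *m B) = invmx B *m U.
  by move=> uU uB; rewrite invmx_mulmx ?unitmx_inv // invmxK.
split=> //; split.
- have -> : CF01 (invmx Q0 *m B0) (invmx Q1 *m B1) =
      map_mx sig (invmx Q0) *m CF01 B0 B1 *m Q1.
    by rewrite /CF01 inv // map_mxM !mulmxA.
  have iS := intmx_sig iV0.
  rewrite redmxM //; last exact: intmxM.
  rewrite redmxM //.
  rewrite redmx_sig // -mulmxA Q1E F01 redmx_inv // Q0E !frob_mxE map_invmx mulKmx //.
  by rewrite map_unitmx -Q0E.
- have -> : CF10 (invmx Q0 *m B0) (invmx Q1 *m B1) =
      map_mx sig (invmx Q1) *m CF10 B0 B1 *m Q0.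
    by rewrite /CF10 inv // map_mxM !mulmxA.
  have iS := intmx_sig iV1.
  rewrite redmxM //; last exact: intmxM.
  rewrite redmxM //.
  rewrite redmx_sig // -mulmxA Q0E F10 redmx_inv // Q1E !frob_mxE map_invmx mulKmx //.
  by rewrite map_unitmx -Q1E.
- have CVE : CV10 (invmx Q0 *m B0) (invmx Q1 *m B1) =
      map_mx sigi (invmx Q1) *m CV10 B0 B1 *m Q0.
    by rewrite /CV10 inv // map_mxM !mulmxA.
  have iS := intmx_sigi iV1.
  (* The compatibility with V is stated after applying Frobenius, which is injective on k. *)
  have : frob_mx (map_mx red (CV10 (invmx Q0 *m B0) (invmx Q1 *m B1))) =
      frob_mx (DV10 k n d).
    rewrite CVE -mulmxA redmxM //; last exact: intmxM.
    rewrite redmxM // Q0E frob_mxE map_mxM -!frob_mxE V10 -redmx_sig // sigimxK.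
    by rewrite redmx_inv // Q1E mulKmx // -Q1E.
  rewrite !frob_mxE; exact: map_mx_inj.
Qed.

Lemma EO_space_odd s : unitary_dieudonne A J M -> (2 * s + 1 <= n)%N ->
  EO_space (2 * s + 1) -> superspecial_gap A M s.
Proof.
move=> HM sn /(EO_space_basis HM)[B0 [B1 [HB [i01 i10 iV] [r01 r10 rV]]]].
have [u0 u1 _] := HB.
by apply: (theta_odd_gap (d := (2 * s + 1)%N) u0 u1) => //; lia.
Qed.

Lemma EO_space_even d s : unitary_dieudonne A J M -> (0 < d <= n)%N -> ~~ odd d ->
  EO_space d -> ~ superspecial_gap A M s.
Proof.
move=> HM dn od /(EO_space_basis HM)[B0 [B1 [HB [i01 i10 iV] [r01 r10 rV]]]].
have [u0 u1 _] := HB.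
exact: (theta_even_no_gap (d := d) u0 u1).
Qed.

(** * Every unitary Dieudonne module reduces to some B(d) + S^(n-d) *)

Lemma adj_neq0_rank (F : fieldType) m (X : 'M[F]_m) :
  \adj X != 0 -> (m <= (\rank X).+1)%N.
Proof.
move=> aX; have [j [i]] := matrix_neq0_entry aX; rewrite mxE => Xij.
have : row' i (col' j X) \in unitmx.
  rewrite unitmxE unitfE; apply: contraNneq Xij => E.
  by rewrite /cofactor E mulr0.
move/mxrank_unit => rk.
have : (\rank (row' i (col' j X)) <= \rank X)%N.
  rewrite row'Esub rowsubE; apply: leq_trans (mxrankM_maxr _ _) _.
  rewrite -mxrank_tr tr_col' row'Esub rowsubE -[\rank X]mxrank_tr.
  exact: mxrankM_maxr.
by rewrite rk; lia.
Qed.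

Lemma DG01_sym (F : fieldType) d : (DG01 F n d)^T = DG01 F n d.
Proof. by rewrite DG01E tr_diag_mx. Qed.

Lemma DG01_sq (F : fieldType) d : DG01 F n d *m DG01 F n d = 1%:M.
Proof.
rewrite DG01E mul_diag_mx; apply/matrixP => i j; rewrite !mxE.
case: (i == j); rewrite ?mulr0 // !mulr1n.
by case: ifP => _; [rewrite -expr2 sqrr_sign | rewrite mulrNN mulr1].
Qed.

(** Adjointness of F and V in the standard space: the pairing and V determine F. *)
Lemma DF10_DV10 (F : fieldType) d :
  DF10 F n d = - (DG01 F n d *m (DV10 F n d)^T *m DG01 F n d).
Proof.
rewrite DG01E mul_diag_mx mul_mx_diag; apply/matrixP => i j; rewrite !mxE.
case: (ltnP i d) => id; case: (ltnP j d) => jd.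
- case: ifP => H1; case: ifP => H2; rewrite ?(mulr0, mul0r, oppr0) //; try lia.
  have -> : (i : nat) = j.+1 by lia.
  by rewrite mulr1 exprS mulN1r mulNr opprK -expr2 sqrr_sign.
- case: ifP => H1; case: ifP => H2; rewrite ?(mulr0, mul0r, oppr0) //; lia.
- case: ifP => H1; case: ifP => H2; rewrite ?(mulr0, mul0r, oppr0) //; lia.
- rewrite eq_sym; case: eqP => _; rewrite ?(mulr0, mul0r, oppr0) //.
  by rewrite mulr1 mulrNN mulr1.
Qed.

Lemma DF01_DV01 (F : fieldType) d : (0 < d)%N ->
  DF01 F n d = - (DG01 F n d *m (DV01 F n d)^T *m DG01 F n d).
Proof.
move=> d0; rewrite DG01E mul_diag_mx mul_mx_diag; apply/matrixP => i j; rewrite !mxE.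
rewrite andbC; case: ifP => [/andP[/eqP-> /eqP->]|]; rewrite ?(mulr0, mul0r, oppr0) //.
by rewrite d0 ltn_predL d0 prednK // expr1 mulr1 mulN1r opprK.
Qed.

(* The last clause says that B0 is dual to B1, so that the pairing has matrix 1. *)
Lemma unitary_graded_basis : unitary_dieudonne A J M ->
  exists c B0 B1, [/\ c != 0, sig c = c, self_dual J c M, graded_basis B0 B1
    & invmx B0 = c^-1 *: (J01 *m B1^T)].
Proof.
move=> [[B [uB HB]] [_ [_ [Hgr [_ [[B1 [_ [u1 _ HB1 _ _]]] [c [c0 sc HJ]]]]]]]].
have uJ : J01 \in unitmx.
  have := mulmxV (ia_Junit HI); rewrite {1}JE -[invmx J]submxK mulmx_block.
  rewrite scalar_mx_block !mul0mx !add0r !addr0 => /eq_block_mx[+ _ _ _].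
  by move/mulmx1_unit => [].
(* By self-duality, y lies in M_0 exactly when c^-1 times its pairing with each row of B1 is
   integral, that is, when y D is integral; the rows of D^-1 are thus the dual basis. *)
pose D := c^-1 *: (J01 *m B1^T).
have uD : D \in unitmx.
  rewrite unitmxZ ?unitfE ?invr_eq0 //.
  by rewrite unitmx_mul uJ unitmx_tr.
exists c, (invmx D), B1; split=> //; last by rewrite invmxK.
have Madd x y : M x -> M y -> M (x + y).
  by move=> /HB/latP Hx /HB/latP Hy; apply/HB/latP; rewrite mulmxDl; exact: intmxD.
have Msplit x : M x <-> part0 M (lsubmx x) /\ part1 M (rsubmx x).
  split=> [/Hgr[]//|[H0 H1]].
  by have := Madd _ _ H0 H1; rewrite add_row_mx addr0 add0r hsubmxK.
have pairE y z : pairing J (row_mx y 0) z = (y *m J01 *m (rsubmx z)^T) 0 0.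
  rewrite /pairing {1}JE mul_row_block !mulmx0 !mul0mx !addr0 -{1}[z]hsubmxK.
  by rewrite tr_row_mx mul_row_col mul0mx add0r.
have H0 y : part0 M y <-> intmx (y *m D).
  rewrite /part0 HJ; split=> [H|H z Mz].
    move=> o i; rewrite ord1.
    have Mi : M (row_mx 0 (row i B1)).
      by apply/HB1; apply: lat_of_row.
    have := H _ Mi; rewrite pairE row_mxKr.
    rewrite /D -scalemxAr mulmxA.
    rewrite [X in W X -> _](_ : _ = (c^-1 *: (y *m J01 *m B1^T)) 0 i) //.
    by rewrite [RHS]mxE; congr (_ * _); rewrite tr_row colE mulmxA -colE mxE.
  have /Msplit[_ /HB1/latP Hz] := Mz.
  rewrite pairE -[rsubmx z](mulmxKV u1) trmx_mul mulmxA.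
  have -> : forall X : 'M[L]_1, c^-1 * X 0 0 = (c^-1 *: X) 0 0 by move=> X; rewrite mxE.
  rewrite scalemxAl -mulmxA scalemxAr -/D.
  by apply: intmxM => //; exact: intmx_tr.
split=> //; first by rewrite unitmx_inv.
by move=> x; rewrite Msplit H0 invmxK HB1 latP.
Qed.

(** The adjointness <F x, y> = <x, V y>^sigma on degree 1, obtained from [ia_JF] by cancelling a
    factor A01 against sigma(A10). *)
Lemma AJ_block : A10 *m J01 = - ((map_mx sig J01)^T *m (map_mx sig A10)^T).
Proof.
have H : A10 *m J01 *m A01^T = - (p *: (map_mx sig J01)^T).
  have := ia_JF HI; rewrite [in LHS]JE [X in X *m _ *m _]AE [X in _ *m X^T]AE tr_block_mx.
  rewrite [X in map_mx _ X]JE map_block_mx !map_mx0 !mulmx_block !trmx0.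
  rewrite !(mul0mx, mulmx0, add0r, addr0) scale_block_mx !scaler0.
  by move=> /eq_block_mx[_ _ -> _]; rewrite map_mxN -map_trmx scalerN.
have /(congr1 (fun X => X *m (map_mx sig A10)^T)) := H.
rewrite -mulmxA -trmx_mul (sA_block).2 tr_scalar_mx mul_mx_scalar mulNmx -scalemxAl.
by rewrite -scalerN; apply: (can_inj (scalerK p_neq0)).
Qed.

(** Lets the signature condition be read as a condition on the determinant of [CV10]. *)
Lemma img_Vop_basis B0 B1 : graded_basis B0 B1 ->
  forall y, part0 (img (Vop A) M) y <-> lat_of (CV10 B0 B1 *m B0) y.
Proof.
move=> [u0 u1 HM] y; have uA : A10 \in unitmx by apply: mulp_unit (mul_pC (sA_block).1).
have EE : CV10 B0 B1 *m B0 = map_mx sigi B1 *m A10 by rewrite /CV10 mulmxKV.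
have uE : map_mx sigi B1 *m A10 \in unitmx by rewrite unitmx_mul map_unitmx u1.
have VE x : Vop A x =
    row_mx (map_mx sigi (rsubmx x) *m A10) (map_mx sigi (lsubmx x) *m A01).
  rewrite /Vop -{1}[x]hsubmxK map_row_mx {1}AE mul_row_block.
  by rewrite !(mul0mx, mulmx0, add0r, addr0).
rewrite latP EE; split=> [[x [/HM[_ H1]]]|Hy].
  rewrite VE => /eq_row_mx[-> _].
  rewrite -[rsubmx x](mulmxKV u1) map_mxM -[_ *m A10]mulmxA mulmxK //.
  exact: intmx_sigi.
exists (row_mx 0 (map_mx sig (y *m invmx (map_mx sigi B1 *m A10)) *m B1)); split.
  apply/HM; rewrite row_mxKl row_mxKr mul0mx mulmxK //; split; first exact: intmx0.
  exact: intmx_sig.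
rewrite VE row_mxKl row_mxKr map_mx0 mul0mx map_mxM sigmxK -mulmxA mulmxKV //.
Qed.

Lemma lat_eq_det (B B' : 'M[L]_n) : B \in unitmx -> B' \in unitmx ->
  (forall x, lat_of B x <-> lat_of B' x) ->
  W (\det (B *m invmx B')) /\ W (\det (B *m invmx B'))^-1.
Proof.
move=> u u' H.
have i1 : intmx (B *m invmx B') by apply: lat_sub => // x /H.
have i2 : intmx (B' *m invmx B) by apply: lat_sub => // x /H.
split; first exact: W_det.
suff -> : (\det (B *m invmx B'))^-1 = \det (B' *m invmx B) by apply: W_det.
by rewrite !det_mulmx !det_inv invfM invrK mulrC.
Qed.

Lemma unitary_EO_space : unitary_dieudonne A J M ->
  exists2 d, (0 < d <= n)%N & EO_space d.
Proof.
move=> HM; have [c [B0 [B1 [c0 sc HJ HB B0E]]]] := unitary_graded_basis HM.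
move: (HM) => [_ [HF [HV [_ [[D [D' [uD uD' HD HD' [v [Wv WVv vE]]]]] _]]]]].
have [u0 u1 HMB] := HB.
have [] := basis_stable HB (rmorph0 _) HF; rewrite -/(CF01 B0 B1) -/(CF10 B0 B1).
have [] := basis_stable HB (rmorph0 _) HV; rewrite -/(CV01 B0 B1) -/(CV10 B0 B1).
move=> iV01 iV10 iF01 iF10.
have F10E : CF10 B0 B1 = - (map_mx sig (CV10 B0 B1))^T.
  have sB0 : (map_mx sig (invmx B0))^T = c^-1 *: (map_mx sig B1 *m (map_mx sig J01)^T).
    by rewrite B0E map_mxZ map_mxM fmorphV /= sc linearZ /= trmx_mul -map_trmx trmxK.
  rewrite /CV10 !map_mxM sigimxK trmx_mul sB0 trmx_mul /CF10 B0E -scalemxAr -scalemxAl.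
  rewrite -scalerN; congr (_ *: _).
  by rewrite -!mulmxA [A10 *m _]mulmxA AJ_block mulNmx mulmxN -!mulmxA.
have VV : CV01 B0 B1 *m (CV10 B0 B1)^T = - p%:M.
  apply: (map_mx_inj (f := sig)); rewrite map_mxM map_mxN map_scalar_mx /= sig_p.
  by rewrite -map_trmx -(CV01_CF10 u0 u1) F10E mulmxN opprK.
have VVt : CV10 B0 B1 *m (CV01 B0 B1)^T = - p%:M.
  by rewrite -[LHS]trmxK trmx_mul trmxK VV linearN /= tr_scalar_mx.
have VtV : (CV10 B0 B1)^T *m CV01 B0 B1 = - p%:M.
  have /mul_pC : - CV01 B0 B1 *m (CV10 B0 B1)^T = p%:M by rewrite mulNmx VV opprK.
  by rewrite mulmxN => <-; rewrite opprK.
have F01E : CF01 B0 B1 = - (map_mx sig (CV01 B0 B1))^T.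
  have uX := mulp_unit (CV10_CF01 u0 u1).
  apply: (can_inj (mulKmx uX)); rewrite (CV10_CF01 u0 u1) mulmxN map_trmx -map_mxM VVt.
  by rewrite map_mxN map_scalar_mx /= sig_p opprK.
have uV : CV10 B0 B1 \in unitmx.
  by rewrite -(map_unitmx sig); apply: mulp_unit (CV10_CF01 u0 u1).
(* M_0 / V M_1 has length one; w gathers v and the unit determinants comparing the bases D', D with
   CV10 B0, B0. *)
have [w [Ww WVw wE]] : exists w, [/\ W w, W w^-1 & \det (CV10 B0 B1) = p * w].
  have uE : CV10 B0 B1 *m B0 \in unitmx by rewrite unitmx_mul uV.
  have [x|W1a W1b] := lat_eq_det uE uD'; first by rewrite -HD' -img_Vop_basis.
  have [x|W2a W2b] := lat_eq_det uD u0.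
    rewrite -HD latP /part0; case: HB => _ _ ->; rewrite row_mxKl row_mxKr mul0mx.
    by split=> [[]//|H]; split=> //; exact: intmx0.
  exists (\det (CV10 B0 B1 *m B0 *m invmx D') * v * \det (D *m invmx B0)); split.
  - by apply: WM => //; exact: WM.
  - by rewrite !invfM; apply: WM => //; exact: WM.
  have E3 : CV10 B0 B1 =
      (CV10 B0 B1 *m B0 *m invmx D') *m (D' *m invmx D) *m (D *m invmx B0).
    by rewrite -!mulmxA (mulKmx uD) (mulKmx uD') mulmxV // mulmx1 mulmxA.
  by rewrite [in LHS]E3 det_mulmx det_mulmx vE expr1; ring.
have w0 : w != 0.
  apply: contraTneq (mulp_unit (CV10_CF01 u0 u1)) => w0.
  by rewrite map_unitmx unitmxE wE w0 mulr0 unitr0.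
have rw : red w != 0.
  apply/eqP => rw; have := redM Ww WVw; rewrite divff // red1 rw mul0r.
  by move/eqP; rewrite oner_eq0.
(* Up to a unit, the adjugate of [CV10] is the transpose of [CV01]: corank at most one modulo p will
   follow from [CV01] being nonzero modulo p. *)
have adjE : \adj (CV10 B0 B1) = - (w *: (CV01 B0 B1)^T).
  apply: (can_inj (mulKmx uV)); rewrite mul_mx_adj wE mulmxN -scalemxAr VVt scalerN opprK.
  by rewrite scale_scalar_mx mulrC.
pose cv01 := map_mx red (CV01 B0 B1); pose cv10 := map_mx red (CV10 B0 B1).
(* Otherwise CV01 / p would be integral and, up to sign and transpose, inverse to [CV10], although
   det CV10 = p w. *)
have cv01_neq0 : cv01 != 0.
  apply/eqP => cv0; pose Y := p^-1 *: CV01 B0 B1.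
  have iY : intmx Y.
    move=> i j; rewrite mxE mulrC; apply/(red_eq0 (iV01 i j)).
    by move/matrixP/(_ i j): cv0; rewrite !mxE.
  have : CV10 B0 B1 *m - Y^T = 1%:M.
    rewrite /Y linearZ /= mulmxN -scalemxAr VVt scalerN opprK scale_scalar_mx.
    by rewrite mulVf ?p_neq0.
  move/(congr1 determinant); rewrite det_mulmx wE det1 => E.
  apply: (wa_Wpinv HS); rewrite -/p -[p^-1]mulr1 -E -mulrA mulKf ?p_neq0 //.
  by apply: WM => //; apply/W_det/intmxN/intmx_tr.
(* V is sigma^-1-linear; after one Frobenius twist a change of basis acts on N as in [fcong]. *)
pose N := frob_mx cv10; pose R := frob_mx cv01.
have scale_neq0 (X : 'M[L]_n) : intmx X -> map_mx red X != 0 ->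
    map_mx red (- (w *: X^T)) != 0.
  move=> iX; apply: contraNneq => /matrixP H; apply/eqP/matrixP => i j.
  have := H j i; rewrite !mxE redN; last exact: WM.
  by rewrite redM // => /eqP; rewrite oppr_eq0 mulf_eq0 (negPf rw) => /eqP.
have rkN : (n <= (\rank N).+1)%N.
  rewrite /N frob_mxE mxrank_map; apply: adj_neq0_rank.
  by rewrite /cv10 -red_adj // adjE; exact: scale_neq0.
have R0 : R != 0 by rewrite /R frob_mxE map_mx_eq0.
have red_p0 : map_mx red (- p%:M) = 0 :> 'M[k]_n.
  apply/matrixP => i j; rewrite !mxE; case: (i == j); rewrite ?mulr1n ?mulr0n.
    by rewrite redN ?red_p ?oppr0 //; exact: Wp.
  by rewrite oppr0 red0.
have NR : N^T *m R = 0.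
  rewrite /N /R !frob_mxE map_trmx -map_mxM map_trmx -redmxM ?VtV //; last exact: intmx_tr.
  by rewrite red_p0 map_mx0.
have RN : R *m N^T = 0.
  rewrite /N /R !frob_mxE map_trmx -map_mxM map_trmx -redmxM ?VV //; last exact: intmx_tr.
  by rewrite red_p0 map_mx0.
have [d [P1 [dn uP1 NE RE]]] := frob_form_standard pchar_k (wa_odd HS) rkN R0 NR RN.
have [d0 _] := andP dn.
rewrite -!frob_mxE in NE RE.
exists d => //.
pose G := DG01 k n d; have GG : G *m G = 1%:M := DG01_sq k d.
have Gt : G^T = G := DG01_sym k d.
have uG : G \in unitmx by have [] := mulmx1_unit GG.
have uP1t : P1^T \in unitmx by rewrite unitmx_tr.
have uFP1 : frob_mx P1 \in unitmx by rewrite frob_mxE map_unitmx.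
have uFP1t : (frob_mx P1)^T \in unitmx by rewrite unitmx_tr.
(* Forced by the pairing: B0 and B1 are dual, so P0 G P1^T must be 1. *)
pose P0 := invmx P1^T *m G.
have FP0 : frob_mx P0 = invmx (frob_mx P1)^T *m G.
  by rewrite /P0 frob_mxE map_mxM -!frob_mxE frob_DG01 frob_mxE map_invmx -map_trmx -frob_mxE.
have rF10 : map_mx red (CF10 B0 B1) = - N^T.
  have iS := intmx_sig iV10.
  rewrite F10E redmxN; last exact: intmx_tr.
  by rewrite -map_trmx redmx_sig.
have rF01 : map_mx red (CF01 B0 B1) = - R^T.
  have iS := intmx_sig iV01.
  rewrite F01E redmxN; last exact: intmx_tr.
  by rewrite -map_trmx redmx_sig.
exists c, B0, B1, P0, P1 => /=; split.
  split=> //; first by rewrite unitmx_block_diag u0.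
  by apply/(graded_basisP u0 u1).
split.
- by rewrite unitmx_block_diag uP1 unitmx_mul unitmx_inv uP1t uG.
- rewrite CF_block // map_block_mx !redmx0 /DF frob_block !frob_mx0 !mulmx_block.
  rewrite !(mul0mx, mulmx0, add0r, addr0); congr block_mx.
  + rewrite rF01 DF01_DV01 // -/G FP0.
    have -> : R = invmx P1^T *m (G *m DV01 k n d) *m invmx (frob_mx P1).
      by rewrite -RE -!mulmxA (mulmxV uFP1) mulmx1 (mulKmx uP1t).
    rewrite !trmx_mul Gt !trmx_inv trmxK mulNmx mulmxN -!mulmxA (mulVmx uP1) mulmx1.
    by rewrite [G *m (G *m _)]mulmxA GG mul1mx.
  + rewrite rF10 DF10_DV10 -/G NE !trmx_mul trmxK Gt /P0 mulNmx mulmxN -!mulmxA.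
    by rewrite (mulKVmx uP1t).
- rewrite CV_block // map_block_mx !redmx0 /DV frob_block !frob_mx0 !mulmx_block.
  rewrite frob_block !(mul0mx, mulmx0, add0r, addr0) !frob_mx0; congr block_mx.
  + rewrite frob_mxE map_mxM -!frob_mxE -/R frob_DV01 /P0 -mulmxA -RE -mulmxA.
    by rewrite (mulKmx uP1t).
  + rewrite frob_mxE map_mxM -!frob_mxE -/N frob_DV10 FP0 NE -!mulmxA.
    by rewrite (mulKVmx uFP1t) GG mulmx1.
- have GE : c^-1 *: (B0 *m J01 *m B1^T) = 1%:M.
    by rewrite -mulmxA scalemxAr -B0E mulmxV.
  rewrite {1}JE tr_block_mx !trmx0 !mulmx_block !(mul0mx, mulmx0, add0r, addr0).
  rewrite scale_block_mx !scaler0 GE /DG !tr_block_mx !trmx0 !mulmx_block.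
  rewrite !(mul0mx, mulmx0, add0r, addr0) map_block_mx !redmx0 redmx1 -/G Gt.
  have P01 : P0 *m G *m P1^T = 1%:M.
    by rewrite /P0 -!mulmxA [G *m (G *m _)]mulmxA GG mul1mx mulVmx.
  congr block_mx; first by rewrite P01.
  have -> : c^-1 *: (B1 *m - J01^T *m B0^T) = - 1%:M.
    rewrite mulmxN mulNmx scalerN -[X in - X]trmxK linearZ /= !trmx_mul !trmxK mulmxA.
    by rewrite GE trmx1.
  rewrite redmxN ?redmx1; last exact: intmx1.
  have P10 : P1 *m G *m P0^T = 1%:M.
    by apply: trmx_inj; rewrite trmx_mul trmxK trmx_mul Gt mulmxA P01 trmx1.
  by rewrite mulmxN mulNmx P10.
Qed.

End Isocrystal.
End Integers.

Theorem mainTheorem10 (S : WittSetting) (HS : WittAxioms S) (n : nat)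
  (A J : 'M[wL S]_(n + n)) (HI : IsoAxioms A J) (hn : (2 <= n)%N)
  (M : 'rV[wL S]_(n + n) -> Prop) (HM : unitary_dieudonne A J M)
  (s : nat) (hs : (2 * s + 1 <= n)%N) :
  EO_stratum A J s M <-> superspecial_gap A M s.
Proof.
split=> [|gap]; first exact: (EO_space_odd HS HI HM hs).
(* The parity of d is settled by the existence of a gap, and its value by the uniqueness of the
   gap. *)
have [d dn Hd] := unitary_EO_space HS HI HM.
have [od|ed] := boolP (odd d); last by case: (EO_space_even HS HI HM dn ed Hd gap).
have dE : d = (2 * d./2 + 1)%N by lia.
have sn : (2 * d./2 + 1 <= n)%N by lia.
rewrite dE in Hd; have gap' := EO_space_odd HS HI HM sn Hd.
suff -> : s = d./2 by exact: Hd.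
case: (ltngtP s d./2) => // lt_s.
  by case: (gap'.2 _ lt_s gap.1).
by case: (gap.2 _ lt_s gap'.1).
Qed.
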